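(* Let $q$ be a prime power and $r,g,a,h$ positive integers with $a\le r\le q+1$ and $ga+h<gr$; put $n=rg$. If there is a function field $F/\mathbb{F}_q$ of genus $\mathfrak g$ having $g$ positive divisors of degree $r$ whose supports are pairwise disjoint, then there exists an MR $(n,r,h,a)$-LRC over a field of size $\ell=q^{2\mathfrak g+\min\{hr,n\}}$.
   Context: A function field $F/\mathbb{F}_q$ has full constant field $\mathbb{F}_q$; divisors are finite formal $\mathbb{Z}$-combinations of places, positive if all coefficients are nonnegative, with degree $\sum m_P\deg P$. Definition: let $\ell$ be a prime power, $a,g,r,h$ positive integers with $ga+h<gr$, $n=gr$, $k=n-ga-h$. An MR (maximally recoverable) $(n,r,h,a)_\ell$-LRC is an $[n,k]$ linear code over $\mathbb{F}_\ell$ with a parity-check matrix $H$ of the block form whose first $ga$ rows are block diagonal with diagonal blocks $A_1,\dots,A_g$ (each $a\times r$, coordinates split into $g$ consecutive groups of size $r$) and whose last $h$ rows are $(D_1|\cdots|D_g)$ with each $D_i$ of size $h\times r$, such that (i) each $A_i$ generates an $[r,a,r-a+1]_\ell$ MDS code, and (ii) every set of $ag+h$ columns of $H$ consisting of any $a$ columns from each group together with any $h$ further columns is linearly independent over $\mathbb{F}_\ell$. ''Over a field of size $\ell$'' means an MR $(n,r,h,a)_\ell$-LRC. *)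

(* Defs.v *)
From mathcomp Require Import all_boot all_order all_algebra.
From Stdlib Require List.
Set Implicit Arguments. Unset Strict Implicit. Unset Printing Implicit Defensive.
Import Order.TTheory GRing.Theory Num.Theory.
Local Open Scope ring_scope.

Section FunctionField.
Variables (K F : fieldType) (iota : {rmorphism K -> F}).

Definition transcendental (x : F) : Prop :=
  forall p : {poly K}, p != 0 -> (map_poly iota p).[x] != 0.

Definition algebraic (z : F) : Prop :=
  exists2 p : {poly K}, p != 0 & (map_poly iota p).[z] = 0.

Definition finite_over_Kx (x : F) : Prop :=
  exists (m : nat) (b : 'I_m -> F), forall y : F,
    exists (p q : 'I_m -> {poly K}), (forall i, q i != 0) /\
      y = \sum_(i < m) ((map_poly iota (p i)).[x] / (map_poly iota (q i)).[x]) * b i.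

Definition function_field : Prop :=
  (exists x, transcendental x /\ finite_over_Kx x) /\
  (forall z, algebraic z -> exists c, z = iota c).

(* Places of F/K, represented by their normalized discrete valuations
   v_P : F -> int (with the convention v 0 = 0 in place of +oo). *)
Definition is_place (v : F -> int) : Prop :=
  v 0 = 0 /\
  (forall x y, x != 0 -> y != 0 -> v (x * y) = v x + v y) /\
  (forall x y, x != 0 -> y != 0 -> x + y != 0 -> v x <= v (x + y) \/ v y <= v (x + y)) /\
  (exists t, t != 0 /\ v t = 1) /\
  (forall c, c != 0 -> v (iota c) = 0).

(* deg P = dim_K (O_P / P) = d *)
Definition place_deg (v : F -> int) (d : nat) : Prop :=
  exists b : 'I_d -> F,
    (forall i, 0 <= v (b i)) /\
    (forall c : 'I_d -> K,
        (\sum_(i < d) iota (c i) * b i == 0 \/ 0 < v (\sum_(i < d) iota (c i) * b i)) ->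
        forall i, c i = 0) /\
    (forall z, 0 <= v z -> exists c : 'I_d -> K,
        (z - \sum_(i < d) iota (c i) * b i == 0) \/ 0 < v (z - \sum_(i < d) iota (c i) * b i)).

Definition is_divisor (D : (F -> int) -> int) : Prop :=
  exists s : seq (F -> int), forall v, D v != 0 -> is_place v /\ List.In v s.

Definition divisor_deg (D : (F -> int) -> int) (d : int) : Prop :=
  exists (s : seq (F -> int)) (ds : seq nat),
    List.NoDup s /\ size ds = size s /\
    (forall v, D v != 0 -> List.In v s) /\
    (forall i, (i < size s)%N ->
       is_place (nth (fun _ => 0) s i) /\ place_deg (nth (fun _ => 0) s i) (nth 0%N ds i)) /\
    d = \sum_(i < size s) D (nth (fun _ => 0) s i) * (nth 0%N ds i)%:Z.

Definition positive_divisor (D : (F -> int) -> int) : Prop := forall v, 0 <= D v.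

Definition in_LD (D : (F -> int) -> int) (f : F) : Prop :=
  f = 0 \/ forall v, is_place v -> - D v <= v f.

Definition dim_LD (D : (F -> int) -> int) (m : nat) : Prop :=
  exists b : 'I_m -> F,
    (forall i, in_LD D (b i)) /\
    (forall c : 'I_m -> K, \sum_(i < m) iota (c i) * b i = 0 -> forall i, c i = 0) /\
    (forall f, in_LD D f -> exists c : 'I_m -> K, f = \sum_(i < m) iota (c i) * b i).

Definition genus (gg : nat) : Prop :=
  (forall D d m, is_divisor D -> divisor_deg D d -> dim_LD D m -> d - m%:Z + 1 <= gg%:Z) /\
  (exists D d m, is_divisor D /\ divisor_deg D d /\ dim_LD D m /\ d - m%:Z + 1 = gg%:Z).

End FunctionField.

Definition mx_at (L : nzRingType) (m n : nat) (H : 'M[L]_(m, n)) (i j : nat) : L :=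
  match (insub i : option 'I_m), (insub j : option 'I_n) with
  | Some i', Some j' => H i' j'
  | _, _ => 0
  end.

(* H is the parity-check matrix (of the block form in the definition) of an
   MR (n,r,h,a)-LRC with n = g*r, coordinates split into g consecutive groups
   of size r. *)
Definition MR_LRC (L : fieldType) (g r h a : nat) (H : 'M[L]_(g * a + h, g * r)) : Prop :=
  (forall (i : 'I_(g * a + h)) (j : 'I_(g * r)),
      (i < g * a)%N -> (i %/ a != j %/ r)%N -> H i j = 0) /\
  (* (i): each A_k generates an [r, a, r-a+1] MDS code *)
  (forall k : 'I_g,
      let A := \matrix_(x < a, y < r) mx_at H (k * a + x)%N (k * r + y)%N in
      \rank A = a /\
      forall u : 'rV[L]_a, u != 0 -> (r - a + 1 <= #|[set y | (u *m A) ord0 y != 0%R]|)%N) /\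
  (* (ii): any a columns from each group plus any h further columns are
     linearly independent *)
  (forall S : {set 'I_(g * r)}, #|S| = (g * a + h)%N ->
      (forall k : 'I_g, (a <= #|[set j in S | (j %/ r)%N == k]|)%N) ->
      forall x : 'cV[L]_(g * r), (forall j, j \notin S -> x j ord0 = 0) ->
        H *m x = 0 -> x = 0).

(* Main.v *)
(** Let [q = #|K|].  Extended Reed-Solomon blocks are used for the local checks and
the Moore rows [alpha_t ^ (q^s)] for the global ones.  Eliminating the local checks over [K] shows
that the code is maximally recoverable as soon as the [alpha_t], cut into [g] blocks of length
[r], have the property that any [min(h, g)] blocks together are linearly independent over [K].
For [h >= g] a basis of the extension field does this.  For [h < g], dually, one needs a
subspace of [K^(g r)] of codimension at most [2 gg + h r] in which no nonzero vector
vanishes on [g - h] blocks: take the residues modulo the given divisors [D_i] of the functions in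
[L(D)], [deg D = r (g - h) - 1].  Such a function vanishing on [g - h] blocks lies in a
Riemann-Roch space of negative degree, and Riemann's inequality bounds the codimension by
[gg + h r].

A divisor of that degree exists by F. K. Schmidt's theorem.  If all degrees were
divisible by [l > 1], an irreducible [phi], [deg phi = e > 1], dividing ['X^(q^l) - 'X] would have
roots in all residue fields, although [F['X] / phi] is a field.  A pair [(E1, E2)] of
positive divisors of [F] then acts as a divisor of this extension, one root of [phi] being assigned
to [E1] and its Frobenius conjugate to [E2]. There are at least [n q^n] pairs of
total degree [n], up to constants; each is cut out, up to boundedly many choices, by a nonzero
element of an [e]-fold Riemann-Roch space with [O(q^n)] elements, since the degree of the norm of
that element bounds the degree of its zeros.

The definition of the genus already yields most of the theory of divisors: it provides a divisor
[D0] with [dim L(D) = deg D + 1 - gg] for all [D >= D0], and comparing [L(D)] with [f L(D)]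
gives the degree of a principal divisor. *)
From HB Require Import structures.
Require Import Defs.
From mathcomp Require Import all_boot all_order all_fingroup all_algebra all_solvable all_field.
From mathcomp Require Import boolp.
From mathcomp Require Import zify ring.
Set Implicit Arguments. Unset Strict Implicit. Unset Printing Implicit Defensive.
Import Order.TTheory GRing.Theory Num.Theory.
Local Open Scope ring_scope.

(** * Linear algebra over the constant field *)

Section LinearAlgebra.
Variables (K F : fieldType) (iota : {rmorphism K -> F}).

Definition comb n (u : 'I_n -> F) (c : 'rV[K]_n) : F :=
  \sum_(i < n) iota (c ord0 i) * u i.

Definition indep n (u : 'I_n -> F) : Prop := forall c, comb u c = 0 -> c = 0.

Definition subspace (V : F -> Prop) : Prop :=
  V 0 /\ forall c f g, V f -> V g -> V (iota c * f + g).

(** Reads [dim_K V <= n], phrased through independent families so that finite dimension need not be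
    known beforehand. *)
Definition bounded (V : F -> Prop) (n : nat) : Prop :=
  forall k (u : 'I_k -> F), (forall i, V (u i)) -> indep u -> (k <= n)%N.

Definition lin_on (V : F -> Prop) a (T : F -> 'rV[K]_a) : Prop :=
  forall c f g, V f -> V g -> T (iota c * f + g) = c *: T f + T g.

Lemma combP n (u : 'I_n -> F) c a b :
  comb u (c *: a + b) = iota c * comb u a + comb u b.
Proof.
rewrite /comb mulr_sumr -big_split; apply: eq_bigr => i _ /=.
by rewrite !mxE rmorphD rmorphM mulrDl mulrA.
Qed.

Lemma comb0 n (u : 'I_n -> F) : comb u 0 = 0.
Proof. by rewrite /comb big1 // => i _; rewrite mxE rmorph0 mul0r. Qed.

Lemma comb_sum n (u : 'I_n -> F) k (c : 'rV[K]_k) (A : 'M[K]_(k, n)) :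
  comb u (c *m A) = comb (fun i => comb u (row i A)) c.
Proof.
rewrite /comb; under [RHS]eq_bigr do rewrite mulr_sumr.
rewrite exchange_big /=; apply: eq_bigr => j _.
rewrite !mxE rmorph_sum mulr_suml; apply: eq_bigr => i _.
by rewrite !mxE rmorphM mulrA.
Qed.

Lemma comb_mul n (u : 'I_n -> F) c x : comb (fun i => x * u i) c = x * comb u c.
Proof. by rewrite /comb mulr_sumr; apply: eq_bigr => i _; rewrite mulrCA. Qed.

Lemma indep_mul n (u : 'I_n -> F) x : x != 0 -> indep u -> indep (fun i => x * u i).
Proof.
move=> x0 iu c; rewrite comb_mul => /eqP; rewrite mulf_eq0 (negbTE x0) /= => /eqP.
exact: iu.
Qed.

Lemma subspace_scale V c f : subspace V -> V f -> V (iota c * f).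
Proof. by move=> [V0 Vl] Vf; rewrite -[_ * _]addr0; apply: Vl. Qed.

Lemma subspaceD V f g : subspace V -> V f -> V g -> V (f + g).
Proof. by move=> [V0 Vl] Vf Vg; rewrite -[f]mul1r -(rmorph1 iota); apply: Vl. Qed.

Lemma subspace_sum V (I : Type) (r : seq I) (P : pred I) (f : I -> F) :
  subspace V -> (forall i, P i -> V (f i)) -> V (\sum_(i <- r | P i) f i).
Proof.
move=> sV Vf; apply: (big_ind V) => //; first by case: sV.
by move=> x y; apply: subspaceD.
Qed.

Lemma subspace_comb V n (u : 'I_n -> F) c :
  subspace V -> (forall i, V (u i)) -> V (comb u c).
Proof. by move=> sV Vu; apply: subspace_sum => // i _; apply: subspace_scale. Qed.

Lemma lin_on0 V a (T : F -> 'rV[K]_a) : subspace V -> lin_on V T -> T 0 = 0.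
Proof.
move=> [V0 _] lT; have := lT (-1) 0 0 V0 V0.
by rewrite mulr0 addr0 scaleN1r addNr.
Qed.

Lemma lin_on_comb V a (T : F -> 'rV[K]_a) n (u : 'I_n -> F) c :
  subspace V -> lin_on V T -> (forall i, V (u i)) ->
  T (comb u c) = c *m \matrix_(i < n) T (u i).
Proof.
move=> sV lT Vu; rewrite mulmx_sum_row /comb.
suff: V (\sum_(i < n) iota (c ord0 i) * u i) /\
  T (\sum_(i < n) iota (c ord0 i) * u i) = \sum_i c 0 i *: row i (\matrix_i0 T (u i0)).
  by case.
elim/big_ind2: _ => [|x1 x2 y1 y2 [Vx Tx] [Vy Ty]|i _].
- by split; [case: sV | apply: lin_on0 lT].
- split; first exact: subspaceD.
  by have := lT 1 x2 y2 Vx Vy; rewrite rmorph1 mul1r scale1r => ->; rewrite Tx Ty.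
- split; first exact: subspace_scale.
  by rewrite -[_ * _]addr0 lT ?(lin_on0 sV lT) ?addr0 ?rowK //; case: sV.
Qed.

(** Rank-nullity: for an independent family of [V], the left kernel of [T] gives independent
    combinations in [W], so it has dimension at most [m], while [T] has rank at most [a]. Asking for
    [T] only on the coordinates of a finite family avoids a linear map on all of [V]. *)
Lemma bounded_ext V W a m : subspace V ->
  (forall k (u : 'I_k -> F), (forall i, V (u i)) ->
    exists T : 'M[K]_(k, a), forall c, c *m T = 0 -> W (comb u c)) ->
  bounded W m -> bounded V (m + a).
Proof.
move=> sV VW bW k u Vu iu.
have [A hA] := VW _ _ Vu.
pose B := row_base (kermx A).
have rB : (\rank (kermx A) <= m)%N.
  apply: (bW _ (fun i => comb u (row i B))) => [i|c].
    apply: hA; rewrite -row_mul.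
    suff -> : B *m A = 0 by apply/rowP => j; rewrite !mxE.
    by apply/sub_kermxP; rewrite eq_row_base.
  rewrite -comb_sum => /iu /eqP.
  by rewrite mulmx_free_eq0 ?row_base_free // => /eqP.
have := rB; rewrite mxrank_ker leq_subLR => /leq_trans -> //.
by rewrite addnC leq_add2l rank_leq_col.
Qed.

Lemma bounded_sub (V W : F -> Prop) m :
  (forall f, V f -> W f) -> bounded W m -> bounded V m.
Proof. by move=> VW bW k u Vu; apply: bW => i; apply: VW. Qed.

Lemma bounded_span V m (b : 'I_m -> F) :
  (forall f, V f -> exists c, f = comb b c) -> bounded V m.
Proof.
move=> sp k u Vu iu.
have [A hA] : exists A : 'M[K]_(k, m), forall i, u i = comb b (row i A).
  have [c hc] := choice (fun i => sp _ (Vu i)).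
  by exists (\matrix_i c i) => i; rewrite rowK.
apply: leq_trans (rank_leq_col A); rewrite leqNgt; apply/negP => rA.
have : kermx A != 0.
  by rewrite -mxrank_eq0 mxrank_ker subn_eq0 -ltnNge.
move/rowV0Pn => [c /sub_kermxP cA c0].
move/negP: c0; apply; apply/eqP/iu.
have -> : comb u c = comb b (c *m A).
  by rewrite comb_sum; apply: eq_bigr => i _; rewrite hA.
by rewrite cA comb0.
Qed.


Definition indep_mod (W : F -> Prop) n (u : 'I_n -> F) : Prop :=
  forall c, W (comb u c) -> c = 0.

Definition fcons n (f : F) (b : 'I_n -> F) (i : 'I_n.+1) : F :=
  oapp b f (unlift ord0 i).

Lemma comb_fcons n f (b : 'I_n -> F) (c : 'rV_n.+1) :
  comb (fcons f b) c = iota (c 0 0) * f + comb b (\row_i c 0 (lift ord0 i)).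
Proof.
rewrite /comb big_ord_recl /fcons unlift_none; congr (_ + _).
by apply: eq_bigr => i _; rewrite liftK mxE.
Qed.

Lemma indep_mod_fcons W n f (b : 'I_n -> F) : subspace W -> indep_mod W b ->
  (forall c, ~ W (f - comb b c)) -> indep_mod W (fcons f b).
Proof.
move=> sW ib nf c; rewrite comb_fcons => Wc.
have [c0|c0] := eqVneq (c 0 0) 0; last first.
  case: (nf (- (c 0 0)^-1 *: \row_i c 0 (lift ord0 i))).
  move/(subspace_scale (c 0 0)^-1 sW): Wc.
  rewrite mulrDr mulrA -rmorphM mulVf // rmorph1 mul1r.
  by rewrite -[_ *: _]addr0 combP comb0 addr0 rmorphN mulNr opprK.
move: Wc; rewrite c0 rmorph0 mul0r add0r => /ib cl.
apply/rowP => i; rewrite mxE; case: (unliftP ord0 i) => [j ->|->] //.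
by have /rowP/(_ j) := cl; rewrite !mxE.
Qed.

(** The family is one of maximal length: an [f] outside its span modulo [W] could be prepended. With
    [W] the maximal ideal of a place this yields bases of residue fields, with [W] zero bases of
    Riemann-Roch spaces. *)
Lemma basis_mod W V n : subspace W ->
  (forall k (u : 'I_k -> F), (forall i, V (u i)) -> indep_mod W u -> (k <= n)%N) ->
  exists m (b : 'I_m -> F), [/\ (m <= n)%N, forall i, V (b i), indep_mod W b &
    forall f, V f -> exists c, W (f - comb b c)].
Proof.
move=> sW bV.
pose P k := `[< exists u : 'I_k -> F, (forall i, V (u i)) /\ indep_mod W u >].
have P0 : exists k, P k.
  exists 0%N; apply/asboolP; exists (fun _ => 0); split=> [[]//|c _].
  by apply/rowP => -[].
have Pn k : P k -> (k <= n)%N by move=> /asboolP[u [Vu iu]]; apply: bV Vu iu.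
case: (ex_maxnP P0 Pn) => m /asboolP[b [Vb ib]] mx.
exists m, b; split=> // [|f Vf]; first by apply: bV Vb ib.
apply: contrapT => nf.
suff /mx : P m.+1 by rewrite ltnn.
apply/asboolP; exists (fcons f b); split.
  by move=> i; rewrite /fcons; case: unlift.
by apply: indep_mod_fcons => // c Wc; apply: nf; exists c.
Qed.

Lemma subspace_zero : subspace (fun x => x = 0).
Proof. by split=> // c f g -> ->; rewrite mulr0 addr0. Qed.

Lemma bounded_basis V n : bounded V n ->
  exists m (b : 'I_m -> F), [/\ (m <= n)%N, forall i, V (b i), indep b &
    forall f, V f -> exists c, f = comb b c].
Proof.
move=> bV; have [m [b [mn Vb ib sb]]] := basis_mod subspace_zero bV.
by exists m, b; split=> // f /sb[c /eqP]; rewrite subr_eq0 => /eqP; exists c.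
Qed.

Lemma indep_sub n m (u : 'I_n -> F) (w : 'I_m -> 'I_n) :
  injective w -> indep u -> indep (fun i => u (w i)).
Proof.
move=> wI iu c uc.
pose A : 'M[K]_(m, n) := \matrix_(i, j) (w i == j)%:R.
have cA : c *m A = 0.
  apply: iu; rewrite comb_sum -[RHS]uc; apply: eq_bigr => i _; congr (_ * _).
  rewrite /comb (bigD1 (w i)) //= !mxE eqxx rmorph1 mul1r big1 ?addr0 // => j ji.
  by rewrite !mxE eq_sym (negbTE ji) rmorph0 mul0r.
apply/rowP => i; have /rowP/(_ (w i)) := cA.
rewrite !mxE (bigD1 i) //= mxE eqxx mulr1 big1 ?addr0 // => j ji.
by rewrite mxE (inj_eq wI) (negbTE ji) mulr0.
Qed.

Lemma comb_row n (u : 'I_n -> F) (c : 'I_n -> K) :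
  comb u (\row_i c i) = \sum_(i < n) iota (c i) * u i.
Proof. by apply: eq_bigr => i _; rewrite mxE. Qed.

Lemma comb_enum (T : finType) (u : T -> F) (c : T -> K) :
  comb (fun j : 'I_#|T| => u (enum_val j)) (\row_j c (enum_val j)) =
  \sum_t iota (c t) * u t.
Proof.
rewrite comb_row -(big_enum_val (A := T) (fun t => iota (c t) * u t)) /=.
by apply: eq_bigl => t; rewrite inE.
Qed.

Lemma indep_enum (T : finType) (u : T -> F) :
  (forall c : T -> K, \sum_t iota (c t) * u t = 0 -> forall t, c t = 0) ->
  indep (fun j : 'I_#|T| => u (enum_val j)).
Proof.
move=> iu c; have -> : c = \row_j c 0 (enum_rank (enum_val j)).
  by apply/rowP => j; rewrite mxE enum_valK.
rewrite (comb_enum _ (fun t => c 0 (enum_rank t))) => /iu c0.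
by apply/rowP => j; rewrite !mxE.
Qed.
End LinearAlgebra.

(** * Places *)

Section Valuation.
Variables (K F : fieldType) (iota : {rmorphism K -> F}).

(* [v x >= k] with the convention [v 0 = +oo]; in [is_place] the value [v 0] is [0]. *)
Definition vge (v : F -> int) (x : F) (k : int) : bool := (x == 0) || (k <= v x).

Variable v : F -> int.
Hypothesis pv : is_place iota v.

Lemma place0 : v 0 = 0. Proof. by case: pv. Qed.

Lemma placeM x y : x != 0 -> y != 0 -> v (x * y) = v x + v y.
Proof. by case: pv => _ [vM _]; apply: vM. Qed.

Lemma place_const c : c != 0 -> v (iota c) = 0.
Proof. by case: pv => _ [_ [_ [_ vc]]]; apply: vc. Qed.

Lemma place1 : v 1 = 0.
Proof. by rewrite -(rmorph1 iota) place_const ?oner_neq0. Qed.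

Lemma placeN x : v (- x) = v x.
Proof.
have [->|x0] := eqVneq x 0; first by rewrite oppr0.
by rewrite -mulN1r placeM ?oppr_eq0 ?oner_neq0 // -(rmorph1 iota) -rmorphN
  place_const ?oppr_eq0 ?oner_neq0 // add0r.
Qed.

Lemma placeV x : v x^-1 = - v x.
Proof.
have [->|x0] := eqVneq x 0; first by rewrite invr0 place0 oppr0.
have := place1; rewrite -(mulfV x0) placeM ?invr_eq0 // => /eqP.
by rewrite addrC addr_eq0 => /eqP.
Qed.

Lemma placeX x n : v (x ^+ n) = v x *+ n.
Proof.
have [->|x0] := eqVneq x 0; first by rewrite expr0n; case: n => [|n] /=;
  rewrite ?place1 ?place0 ?mul0rn.
elim: n => [|n IH]; first by rewrite expr0 place1 mulr0n.
by rewrite exprS placeM ?expf_neq0 // IH mulrS.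
Qed.

Lemma vge0 k : vge v 0 k. Proof. by rewrite /vge eqxx. Qed.

Lemma vge_le x k l : l <= k -> vge v x k -> vge v x l.
Proof. by move=> lk /orP[x0|xk]; rewrite /vge ?x0 // (le_trans lk xk) orbT. Qed.

Lemma vgeD x y k : vge v x k -> vge v y k -> vge v (x + y) k.
Proof.
rewrite /vge; have [->|x0] := eqVneq x 0; first by rewrite add0r.
have [->|y0] := eqVneq y 0; first by rewrite addr0 (negbTE x0).
have [//|xy0] := eqVneq (x + y) 0; rewrite /= => xk yk.
case: pv => _ [_ [vD _]].
by case: (vD x y x0 y0 xy0); apply: le_trans.
Qed.

Lemma vgeM x y k l : vge v x k -> vge v y l -> vge v (x * y) (k + l).
Proof.
rewrite /vge; have [->|x0] := eqVneq x 0; first by rewrite mul0r eqxx.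
have [->|y0] := eqVneq y 0; first by rewrite mulr0 eqxx.
by rewrite mulf_eq0 (negbTE x0) (negbTE y0) /= placeM //; apply: lerD.
Qed.

Lemma vgeN x k : vge v (- x) k = vge v x k.
Proof. by rewrite /vge oppr_eq0 placeN. Qed.

Lemma vgeB x y k : vge v x k -> vge v y k -> vge v (x - y) k.
Proof. by move=> xk yk; rewrite vgeD ?vgeN. Qed.

Lemma vge_const c : vge v (iota c) 0.
Proof.
rewrite /vge fmorph_eq0; have [//|c0] := eqVneq c 0.
by rewrite place_const.
Qed.

Lemma vge1 : vge v 1 0. Proof. by rewrite -(rmorph1 iota) vge_const. Qed.

Lemma vgeX x n k : vge v x k -> vge v (x ^+ n) (k *+ n).
Proof.
by move=> xk; elim: n => [|n IH]; rewrite ?expr0 ?mulr0n ?vge1 // exprS mulrS vgeM.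
Qed.

Lemma vge_sum (I : Type) (r : seq I) (P : pred I) (f : I -> F) k :
  (forall i, P i -> vge v (f i) k) -> vge v (\sum_(i <- r | P i) f i) k.
Proof.
move=> fk; apply: (big_ind (fun x => vge v x k)) => //; first exact: vge0.
by move=> x y; apply: vgeD.
Qed.

Lemma vge_prod (I : Type) (r : seq I) (P : pred I) (f : I -> F) (k : I -> int) :
  (forall i, P i -> vge v (f i) (k i)) ->
  vge v (\prod_(i <- r | P i) f i) (\sum_(i <- r | P i) k i).
Proof.
move=> fk; apply: (big_ind2 (fun x y => vge v x y)) => //; first exact: vge1.
by move=> x1 x2 y1 y2; apply: vgeM.
Qed.

Lemma vge_scale c x k : vge v x k -> vge v (iota c * x) k.
Proof. by move=> xk; rewrite -[k]add0r vgeM ?vge_const. Qed.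

Lemma vge_subspace k : subspace iota (fun x => vge v x k).
Proof. by split=> [|c f g fk gk]; rewrite ?vge0 // vgeD ?vge_scale. Qed.

Lemma vge_0E x : vge v x 0 = (0 <= v x).
Proof. by rewrite /vge; have [->|//] := eqVneq; rewrite place0 lexx. Qed.

Lemma vge_1P x : (x == 0 \/ 0 < v x) <-> vge v x 1.
Proof.
rewrite /vge; case: eqP => _ /=; first by split=> // _; left.
by split=> [[//|x0]|x0]; [lia | right; lia].
Qed.

Lemma vge_horner (p : {poly K}) x : vge v x 0 -> vge v (map_poly iota p).[x] 0.
Proof.
move=> x0; rewrite horner_coef; apply: vge_sum => i _.
by rewrite coef_map; apply: vge_scale; rewrite -(mul0rn _ i) vgeX.
Qed.

Lemma exists_val k : exists2 s, s != 0 & v s = k.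
Proof.
case: pv => _ [_ [_ [[t [t0 vt]] _]]].
case: k => n; first by exists (t ^+ n); rewrite ?expf_neq0 // placeX vt natz.
exists (t ^- n.+1); rewrite ?invr_eq0 ?expf_neq0 // placeV placeX vt NegzE.
by rewrite natz.
Qed.

Lemma vge_div x s k l : s != 0 -> v s = l -> vge v x (k + l) = vge v (x / s) k.
Proof.
move=> s0 vs; rewrite /vge; have [->|x0] := eqVneq x 0; first by rewrite mul0r eqxx.
by rewrite mulf_eq0 invr_eq0 (negbTE x0) (negbTE s0) placeM ?invr_eq0 // placeV vs
  lerBrDr.
Qed.

(** Representatives, in the valuation ring, of a [K]-basis of the residue field of [v]. *)
Definition residue_basis d (b : 'I_d -> F) : Prop :=
  [/\ forall i, vge v (b i) 0, indep_mod iota (fun x => vge v x 1) b &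
   forall z, vge v z 0 -> exists c, vge v (z - comb iota b c) 1].

Lemma place_degP d : place_deg iota v d <-> exists b : 'I_d -> F, residue_basis b.
Proof.
split=> [[b [b0 [ib sb]]]|[b [b0 ib sb]]].
- exists b; split=> [i|c cb|z]; first by rewrite vge_0E.
    apply/rowP => i; rewrite mxE; move: i; apply: ib; exact/vge_1P.
  rewrite vge_0E => /sb[c /vge_1P zc]; exists (\row_i c i).
  by rewrite comb_row.
- exists b; split=> [i|]; first by rewrite -vge_0E.
  split=> [c cb i|z].
    have /rowP/(_ i) : \row_i c i = 0 by apply: ib; rewrite comb_row; apply/vge_1P.
    by rewrite !mxE.
  rewrite -vge_0E => /sb[c zc]; exists (c ord0); exact/vge_1P.
Qed.

Lemma residue_basis_le d b n (u : 'I_n -> F) : @residue_basis d b ->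
  (forall i, vge v (u i) 0) -> indep_mod iota (fun x => vge v x 1) u -> (n <= d)%N.
Proof.
move=> [b0 ib sb] u0 iu.
have [c hc] := choice (fun i => sb _ (u0 i)).
pose A := \matrix_i c i.
apply: leq_trans (rank_leq_col A); rewrite leqNgt; apply/negP => rA.
have : kermx A != 0 by rewrite -mxrank_eq0 mxrank_ker subn_eq0 -ltnNge.
move/rowV0Pn => [x /sub_kermxP xA x0].
move/negP: x0; apply; apply/eqP/iu.
rewrite -[comb _ _ _]subr0 -(comb0 iota b) -xA comb_sum /comb -sumrB.
apply: vge_sum => i _; rewrite -mulrBr vge_scale //.
by have := hc i; rewrite rowK.
Qed.

Lemma place_deg_uniq d e : place_deg iota v d -> place_deg iota v e -> d = e.
Proof.
move=> /place_degP[b hb] /place_degP[b' hb']; apply/eqP; rewrite eqn_leq.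
case: (hb) (hb') => b0 ib _ [b0' ib' _].
by rewrite (residue_basis_le hb' b0 ib) (residue_basis_le hb b0' ib').
Qed.

Lemma place_deg_gt0 d : place_deg iota v d -> (0 < d)%N.
Proof.
move=> /place_degP[b hb].
apply: (@residue_basis_le _ _ 1 (fun=> 1) hb) => [_|c]; first exact: vge1.
rewrite /comb big_ord1 mulr1 => c1; apply/rowP => i; rewrite mxE ord1; apply/eqP.
by apply: contraLR c1 => c0; rewrite /vge fmorph_eq0 (negbTE c0) place_const.
Qed.

(* Taylor expansion in a local parameter. *)
Lemma local_expansion d k e : place_deg iota v d ->
  exists T : F -> 'rV[K]_(e * d), lin_on iota (fun x => vge v x k) T /\
    forall f, vge v f k -> T f = 0 -> vge v f (k + e%:Z).
Proof.
move=> /place_degP[b [b0 ib sb]]; elim: e k => [|e IH] k.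
  by exists (fun _ => 0); split=> [c f g _ _|f fk _]; rewrite ?scaler0 ?addr0.
have [s s0 vs] := exists_val k.
have [T2 [lT2 kT2]] := IH (k + 1).
have {}sb f : exists c, vge v f k -> vge v (f / s - comb iota b c) 1.
  have [fk|fk] := pselect (vge v f k); last by exists 0.
  have [|c hc] := sb (f / s); last by exists c.
  by rewrite -(vge_div _ _ s0 vs) add0r.
have [T1 hT1] := choice sb.
(* Coordinates modulo the maximal ideal are unique, which makes the leading coefficient [T1]
   linear. *)
have lT1 : lin_on iota (fun x => vge v x k) T1.
  move=> c f g fk gk; apply/eqP; rewrite -subr_eq0; apply/eqP; apply: ib.
  have hcfg : vge v (iota c * f + g) k by rewrite vgeD ?vge_scale.
  have := vgeB (vgeD (vge_scale c (hT1 _ fk)) (hT1 _ gk)) (hT1 _ hcfg).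
  set X := (X in vge v X 1).
  suff -> : X = comb iota b (T1 (iota c * f + g) - (c *: T1 f + T1 g)) by [].
  rewrite addrC -scaleN1r combP rmorphN rmorph1 mulN1r combP {}/X.
  by field.
(* Removing the leading term raises the value to at least [k + 1]; the later coefficients are those
   of the remainder. *)
pose res f := f - s * comb iota b (T1 f).
have hres f : vge v f k -> vge v (res f) (k + 1).
  move=> /hT1; rewrite [k + 1]addrC (vge_div _ _ s0 vs) mulrBl.
  by rewrite [s * _]mulrC mulfK.
exists (fun f => row_mx (T1 f) (T2 (res f)) : 'rV_(d + e * d)); split.
  move=> c f g fk gk; rewrite scale_row_mx add_row_mx -lT1 //; congr row_mx.
  rewrite -lT2 ?hres //; congr T2; rewrite /res lT1 // combP; ring.
move=> f fk; rewrite -(row_mx0 _ 1 d (e * d)) => /eq_row_mx[T1f T2f].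
have := kT2 _ (hres _ fk) T2f.
by rewrite /res T1f comb0 mulr0 subr0 -addrA.
Qed.

End Valuation.

(** * Finiteness of residue degrees *)

Section FiniteDegree.
Variables (K F : fieldType) (iota : {rmorphism K -> F}).
Variables (x : F) (m : nat) (b : 'I_m -> F).
Hypothesis tx : transcendental iota x.
Hypothesis fx : forall y : F,
    exists (p q : 'I_m -> {poly K}), (forall i, q i != 0) /\
      y = \sum_(i < m) ((map_poly iota (p i)).[x] / (map_poly iota (q i)).[x]) * b i.

Local Notation ev p := ((map_poly iota p).[x]).

Let evM p q : ev (p * q) = ev p * ev q.
Proof. by rewrite rmorphM hornerM. Qed.

Let ev_sum (I : Type) (r : seq I) (P : pred I) (p : I -> {poly K}) :
  ev (\sum_(i <- r | P i) p i) = \sum_(i <- r | P i) ev (p i).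
Proof. by rewrite rmorph_sum horner_sum. Qed.

(** Combinations of [b] with coefficients in [K[x]] of degree less than [k]. These spaces have
    dimension at most [m * k], and multiplication by a fixed element of [F], once a denominator is
    cleared, shifts [k] by a constant. *)
Definition span_le k (y : F) : Prop := exists R : 'I_m -> {poly K},
  (forall i, size (R i) <= k)%N /\ y = \sum_(i < m) ev (R i) * b i.

Lemma span_le_bounded k : bounded iota (span_le k) (m * k).
Proof.
have -> : (m * k)%N = #|{: 'I_m * 'I_k}| by rewrite card_prod !card_ord.
pose B (p : 'I_m * 'I_k) := x ^+ p.2 * b p.1.
apply: (@bounded_span _ _ _ _ _ (fun j => B (enum_val j))) => f [R [sR ->]].
pose c (p : 'I_m * 'I_k) := (R p.1)`_p.2.
exists (\row_j c (enum_val j)); rewrite (comb_enum iota B c).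
rewrite -(pair_bigA _ (fun i (j : 'I_k) => iota (R i)`_j * B (i, j))) /=.
apply: eq_bigr => i _; rewrite (@horner_coef_wide _ k) ?size_map_poly //.
by rewrite mulr_suml; apply: eq_bigr => j _; rewrite coef_map mulrA.
Qed.

Lemma span_leW k l y : (k <= l)%N -> span_le k y -> span_le l y.
Proof. by move=> kl [R [sR ->]]; exists R; split=> // i; apply: leq_trans kl. Qed.

Lemma span_leM k (p : {poly K}) y : span_le k y -> span_le (k + size p) (ev p * y).
Proof.
move=> [R [sR ->]]; exists (fun i => p * R i); split=> [i|].
  by apply: leq_trans (size_polyMleq _ _) _; have := sR i; lia.
by rewrite mulr_sumr; apply: eq_bigr => i _; rewrite evM mulrA.
Qed.

Lemma span_le_denom y : exists (Q : {poly K}) k, Q != 0 /\ span_le k (ev Q * y).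
Proof.
have [p [q [q0 ->]]] := fx y.
pose R i := p i * \prod_(j < m | j != i) q j.
exists (\prod_i q i), (\max_i size (R i)); split; first by apply/prodf_neq0 => i _.
exists R; split=> [i|]; first by apply: leq_bigmax.
rewrite mulr_sumr; apply: eq_bigr => i _.
rewrite mulrA; congr (_ * _); rewrite /R (bigD1 i) //= !evM mulrC -mulrA.
by congr (_ * _); rewrite mulrA mulVf ?mul1r // tx.
Qed.

Lemma span_le_common_denom n (y : 'I_n -> F) :
  exists (Q : {poly K}) k, Q != 0 /\ forall i, span_le k (ev Q * y i).
Proof.
have [Q hQ] := choice (fun i => span_le_denom (y i)).
have [k hk] := choice hQ.
pose P i := \prod_(j < n | j != i) Q j.
exists (\prod_i Q i), (\max_i (k i + size (P i)))%N; split.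
  by apply/prodf_neq0 => i _; case: (hk i).
move=> i; apply: span_leW (leq_bigmax i) _.
have -> : ev (\prod_i Q i) * y i = ev (P i) * (ev (Q i) * y i).
  by rewrite (bigD1 i) //= evM -mulrA mulrCA.
by apply: span_leM; case: (hk i).
Qed.

(** It suffices to clear the denominators of the finitely many products [t * b i]; hence [Q] and [C]
    depend on [t] alone. *)
Lemma span_le_mul t : exists (Q : {poly K}) C, Q != 0 /\
  forall k y, span_le k y -> span_le (k + C) (ev Q * t * y).
Proof.
have [Q [C [Q0 hQ]]] := span_le_common_denom (fun i => t * b i).
exists Q, C; split=> // k y [R [sR ->]].
have [S hS] := choice hQ.
exists (fun j => \sum_i R i * S i j); split=> [j|].
  apply: leq_trans (size_sum _ _ _) _; apply/bigmax_leqP => i _.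
  apply: leq_trans (size_polyMleq _ _) _.
  by have := sR i; case: (hS i) => /(_ j); lia.
rewrite mulr_sumr; under [RHS]eq_bigr do rewrite ev_sum mulr_suml.
rewrite exchange_big /=; apply: eq_bigr => i _.
rewrite mulrCA -mulrA; case: (hS i) => _ ->; rewrite mulr_sumr.
by apply: eq_bigr => j _; rewrite evM mulrA.
Qed.

Section Place.
Variable v : F -> int.
Hypothesis pv : is_place iota v.

(** In a relation, let the coefficients of all powers of [t] below the [i]-th vanish. The remaining
    terms give [t ^+ i * comb iota z (d i)] value at least [i + 1], so the combination of the [z j]
    has positive value and [d i = 0]. *)
Lemma parameter_indep t n (z : 'I_n -> F) M : t != 0 -> v t = 1 ->
  (forall j, vge v (z j) 0) -> indep_mod iota (fun x => vge v x 1) z ->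
  indep iota (fun p : 'I_#|{: 'I_M * 'I_n}| =>
    t ^+ (enum_val p).1 * z (enum_val p).2).
Proof.
move=> t0 vt z0 iz.
apply: (indep_enum (u := fun p : 'I_M * 'I_n => t ^+ p.1 * z p.2)) => c hc.
pose d (i : 'I_M) : 'rV[K]_n := \row_j c (i, j).
have hd : \sum_(i < M) t ^+ i * comb iota z (d i) = 0.
  rewrite -[RHS]hc; under eq_bigr do rewrite comb_row mulr_sumr.
  by rewrite pair_bigA; apply: eq_bigr => -[i j] _; rewrite mulrCA.
suff d0 i : d i = 0.
  by move=> [i j]; have /rowP/(_ j) := d0 i; rewrite !mxE.
have [k] := ubnP i; elim: k i => // k IH i /ltnSE ik.
apply: iz.
suff : vge v (t ^+ i * comb iota z (d i)) (1 + i%:Z).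
  rewrite (@vge_div _ _ _ _ pv _ (t ^+ i)) ?expf_neq0 //; last first.
    by rewrite (placeX pv) vt natz.
  by rewrite [_ * comb _ _ _]mulrC mulfK ?expf_neq0.
move: hd; rewrite (bigD1 i) //= => /eqP; rewrite addr_eq0 => /eqP ->.
rewrite (vgeN pv); apply: (vge_sum pv) => j ji.
have [lji|] := ltnP j i; first by rewrite IH ?comb0 ?mulr0 ?vge0 //; lia.
rewrite leq_eqVlt eq_sym (negbTE ji : (_ == _ :> nat) = false) /= => lij.
apply: (@vge_le _ _ _ (j%:Z + 0)); first by lia.
apply: (vgeM pv); first by rewrite -natz -vt; apply: (vgeX pv); rewrite /vge lexx orbT.
by apply: (vge_sum pv) => l _; apply: (vge_scale pv).
Qed.

(** Let [n] residues be independent. The [M * n] products [t ^+ i * z j], all multiplied by one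
    denominator, are independent in a space of dimension at most [m * (k0 + M * (C + size Q))]. For
    large [M] this forces [n <= m * (C + size Q)]. *)
Lemma exists_place_deg : exists d, place_deg iota v d.
Proof.
have [t t0 vt] := exists_val pv 1.
have [Q [C [Q0 hQ]]] := span_le_mul t.
have [|d [z [_ z0 iz sz]]] := @basis_mod _ _ iota (fun x => vge v x 1)
  (fun x => vge v x 0) (m * (C + size Q)) (vge_subspace pv 1).
  move=> n z z0 iz; rewrite leqNgt; apply/negP => nC.
  have [Qz [k0 [Qz0 hz]]] := span_le_common_denom z.
  (* Just above [m * k0]: if [n > m * (C + size Q)], then [M * n] exceeds the dimension bound. *)
  pose M := (m * k0).+1.
  have /(indep_mul (x := ev Qz * ev Q ^+ M)) := @parameter_indep t n z M t0 vt z0 iz.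
  have Qn : ev Qz * ev Q ^+ M != 0 by rewrite mulf_neq0 ?expf_neq0 ?tx.
  move=> /(_ Qn) /(@span_le_bounded (k0 + M * (C + size Q))).
  suff H (i : 'I_M) j : span_le (k0 + M * (C + size Q)) (ev Qz * ev Q ^+ M * (t ^+ i * z j)).
    move=> /(_ (fun p => H _ _)); rewrite card_prod !card_ord.
    rewrite /M; nia.
  have -> : ev Qz * ev Q ^+ M * (t ^+ i * z j) =
    ev Q ^+ (M - i) * ((ev Q * t) ^+ i * (ev Qz * z j)).
    have -> : ev Q ^+ M = ev Q ^+ (M - i) * ev Q ^+ i.
      by rewrite -exprD subnK // ltnW.
    rewrite exprMn; ring.
  have H1 l : span_le (k0 + l * C) ((ev Q * t) ^+ l * (ev Qz * z j)).
    elim: l => [|l IH]; first by rewrite expr0 mul1r mul0n addn0.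
    by rewrite exprS -mulrA mulSnr addnA; apply: hQ.
  have H2 l : span_le (k0 + i * C + l * size Q) (ev Q ^+ l * ((ev Q * t) ^+ i * (ev Qz * z j))).
    elim: l => [|l IH]; first by rewrite expr0 mul1r mul0n addn0.
    by rewrite exprS -mulrA mulSnr addnA; apply: span_leM.
  apply: span_leW (H2 _); have := ltn_ord i; nia.
exists d; apply/(place_degP pv); by exists z; split.
Qed.
End Place.
End FiniteDegree.

(** * Divisors and Riemann-Roch spaces *)

Lemma InP (T : eqType) (x : T) s : List.In x s <-> x \in s.
Proof.
elim: s => //= y s IH; rewrite inE; split=> [[->|/IH ->]|/orP[/eqP ->|/IH]].
- by rewrite eqxx.
- by rewrite orbT.
- by left.
- by right.
Qed.

Lemma NoDupP (T : eqType) (s : seq T) : List.NoDup s <-> uniq s.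
Proof.
elim: s => [|x s IH] /=; first by split=> // _; constructor.
split=> [h|/andP[xs us]].
  by inversion h; subst; apply/andP; split; [apply/negP => /InP | apply/IH].
by constructor; [move/InP; apply/negP | apply/IH].
Qed.

Section Divisors.
Variables (K F : fieldType) (iota : {rmorphism K -> F}).
Local Notation place := (F -> int).
Local Notation div := (place -> int).

(** A total function; the default 0 is never met at a place, by [place_degE]. *)
Definition pdeg (v : place) : nat :=
  if pselect (exists d, place_deg iota v d) is left h then projT1 (cid h) else 0%N.

Hypothesis place_degE : forall v, is_place iota v -> exists d, place_deg iota v d.

Lemma pdegP v : is_place iota v -> place_deg iota v (pdeg v).
Proof.
move=> /place_degE pv; rewrite /pdeg.
by case: pselect => // h; case: cid.
Qed.

Lemma pdeg_uniq v d : is_place iota v -> place_deg iota v d -> d = pdeg v.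
Proof. by move=> pv vd; apply: (place_deg_uniq pv vd); apply: pdegP. Qed.

Lemma pdeg_gt0 v : is_place iota v -> (0 < pdeg v)%N.
Proof. by move=> pv; apply: place_deg_gt0 (pdegP pv). Qed.

Definition carries (s : seq place) (D : div) : Prop :=
  [/\ uniq s, forall v, v \in s -> is_place iota v & forall v, D v != 0 -> v \in s].

(** Any list of places containing the support gives the same sum ([sum_carries]), so two divisors
    can be compared on a common list. *)
Definition hasdeg (D : div) (d : int) : Prop :=
  exists s, carries s D /\ d = \sum_(v <- s) D v * (pdeg v)%:Z.

Lemma sum_carries s s' D : carries s D -> carries s' D ->
  \sum_(v <- s) D v * (pdeg v)%:Z = \sum_(v <- s') D v * (pdeg v)%:Z.
Proof.
have H t : \sum_(v <- t) D v * (pdeg v)%:Z =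
    \sum_(v <- [seq v <- t | D v != 0]) D v * (pdeg v)%:Z.
  rewrite big_filter (bigID (fun v => D v != 0)) /= [X in _ + X]big1 ?addr0 // => v.
  by rewrite negbK => /eqP ->; rewrite mul0r.
move=> [us _ sD] [us' _ sD']; rewrite H [RHS]H; apply: perm_big.
apply: uniq_perm; rewrite ?filter_uniq // => v; rewrite !mem_filter.
by have [//|/= Dv] := eqVneq (D v) 0; rewrite sD ?sD'.
Qed.

Lemma hasdeg_carries s D d : carries s D -> hasdeg D d ->
  d = \sum_(v <- s) D v * (pdeg v)%:Z.
Proof. by move=> sD [s' [sD' ->]]; apply: sum_carries. Qed.

Lemma hasdeg_uniq D d e : hasdeg D d -> hasdeg D e -> d = e.
Proof. by move=> [s [sD ->]] /(hasdeg_carries sD). Qed.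

Lemma hasdeg_common D E d e : hasdeg D d -> hasdeg E e ->
  exists s, [/\ carries s D, carries s E,
    d = \sum_(v <- s) D v * (pdeg v)%:Z & e = \sum_(v <- s) E v * (pdeg v)%:Z].
Proof.
move=> hD hE; case: (hD) (hE) => s [[_ ps sD] _] [s' [[_ ps' sE] _]].
have cD : carries (undup (s ++ s')) D.
  split=> [|v|v /sD]; rewrite ?undup_uniq // mem_undup mem_cat.
    by case/orP; [apply: ps | apply: ps'].
  by move=> ->.
have cE : carries (undup (s ++ s')) E.
  by case: cD => us pp _; split=> // v /sE; rewrite mem_undup mem_cat => ->; rewrite orbT.
by exists (undup (s ++ s')); split=> //; apply: hasdeg_carries.
Qed.

Lemma hasdeg_ext D E d : (forall v, D v = E v) -> hasdeg D d -> hasdeg E d.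
Proof. by move=> /funext ->. Qed.

Lemma hasdegD D E d e : hasdeg D d -> hasdeg E e ->
  hasdeg (fun v => D v + E v) (d + e).
Proof.
move=> /hasdeg_common h /h[s [[us ps sD] [_ _ sE] -> ->]].
exists s; split; last by rewrite -big_split; apply: eq_bigr => v _; rewrite mulrDl.
split=> // v; apply: contraNT => vs.
have /eqP -> : D v == 0 by apply: contraNT vs; apply: sD.
have /eqP -> : E v == 0 by apply: contraNT vs; apply: sE.
by rewrite addr0.
Qed.

Lemma hasdegZ D d a : hasdeg D d -> hasdeg (fun v => a * D v) (a * d).
Proof.
move=> [s [[us ps sD] ->]]; exists s; split.
  by split=> // v; rewrite mulf_eq0 negb_or => /andP[_ /sD].
by rewrite mulr_sumr; apply: eq_bigr => v _; rewrite mulrA.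
Qed.

Lemma hasdegB D E d e : hasdeg D d -> hasdeg E e ->
  hasdeg (fun v => D v - E v) (d - e).
Proof.
move=> hD /(hasdegZ (-1)) /(hasdegD hD); rewrite mulN1r; apply: hasdeg_ext => v.
by rewrite mulN1r.
Qed.

Lemma hasdeg0 : hasdeg (fun _ => 0) 0.
Proof. by exists [::]; rewrite big_nil; split=> //; split=> // v; rewrite eqxx. Qed.

Lemma hasdeg_le D E d e : (forall v, D v <= E v) -> hasdeg D d -> hasdeg E e -> d <= e.
Proof.
move=> DE /hasdeg_common h /h[s [_ _ -> ->]].
by apply: ler_sum => v _; apply: ler_wpM2r.
Qed.

Lemma hasdeg_ge0 D d : (forall v, 0 <= D v) -> hasdeg D d -> 0 <= d.
Proof. by move=> D0; apply: hasdeg_le D0 hasdeg0. Qed.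

Lemma hasdeg_max D E d e : hasdeg D d -> hasdeg E e ->
  exists m, hasdeg (fun v => Num.max (D v) (E v)) m.
Proof.
move=> /hasdeg_common h /h[s [[us ps sD] [_ _ sE] _ _]].
exists (\sum_(v <- s) Num.max (D v) (E v) * (pdeg v)%:Z), s; split=> //.
split=> // v; apply: contraR => vs.
have /eqP -> : D v == 0 by apply: contraNT vs; apply: sD.
have /eqP -> : E v == 0 by apply: contraNT vs; apply: sE.
by rewrite maxxx.
Qed.

Definition point (v : place) : div := fun w => (w == v)%:R.

Lemma hasdeg_point v : is_place iota v -> hasdeg (point v) (pdeg v)%:Z.
Proof.
move=> pv; exists [:: v]; split; last by rewrite big_seq1 /point eqxx mul1r.
split=> // w; rewrite inE; first by move/eqP ->.
by rewrite /point; case: (w == v); rewrite ?eqxx.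
Qed.

Lemma divisor_degP D d : divisor_deg iota D d -> hasdeg D d.
Proof.
move=> [s [ds [/NoDupP us [sds [sD [hs ->]]]]]].
have ps v : v \in s -> is_place iota v.
  by move=> /(nthP (fun _ => 0))[i si <-]; case: (hs i si).
exists s; split; first by split=> // v /sD /InP.
rewrite (big_nth (fun _ => 0)) big_mkord; apply: eq_bigr => i _.
by case: (hs i (ltn_ord i)) => pv dv; rewrite (pdeg_uniq pv dv).
Qed.

Lemma hasdegP D d : hasdeg D d -> is_divisor iota D /\ divisor_deg iota D d.
Proof.
move=> [s [[us ps sD] ->]]; split.
  by exists s => v /sD vs; split; [apply: ps | apply/InP].
exists s, [seq pdeg v | v <- s]; split; first exact/NoDupP.
rewrite size_map; split=> //; split; first by move=> v /sD /InP.
split=> [i si|].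
  have pv := ps _ (mem_nth (fun _ => 0) si).
  by rewrite (nth_map (fun _ => 0)) //; split=> //; apply: pdegP.
rewrite (big_nth (fun _ => 0)) big_mkord; apply: eq_bigr => i _.
by rewrite (nth_map (fun _ => 0)).
Qed.

Definition LD (D : div) (f : F) : Prop :=
  forall v, is_place iota v -> vge v f (- D v).

Lemma LDP D f : in_LD iota D f <-> LD D f.
Proof.
split=> [[->|h] v pv|h]; first exact: vge0.
  by rewrite /vge h ?orbT.
have [->|f0] := eqVneq f 0; first by left.
by right=> v /h; rewrite /vge (negbTE f0).
Qed.

Lemma LD_subspace D : subspace iota (LD D).
Proof.
split=> [v _|c f g hf hg v pv]; first exact: vge0.
by apply: (vgeD pv); [apply: (vge_scale pv); apply: hf | apply: hg].
Qed.

Lemma LD_le D E f : (forall v, D v <= E v) -> LD D f -> LD E f.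
Proof. by move=> DE h v pv; apply: vge_le (h v pv); rewrite lerN2. Qed.

Lemma LDM D E f g : LD D f -> LD E g -> LD (fun v => D v + E v) (f * g).
Proof. by move=> hf hg v pv; rewrite opprD; apply: (vgeM pv); [apply: hf|apply: hg]. Qed.

(** At [v] the first [E v] Taylor coefficients, each with values in the residue field, amount to
    [E v * pdeg v] linear conditions. The family [w v] may vary with the place, which is needed to
    evaluate at roots chosen separately at each place. *)
Lemma local_conditions n (s : seq place) (w : place -> 'I_n -> F) (k E : div) :
  (forall v, v \in s -> is_place iota v) ->
  (forall v i, v \in s -> vge v (w v i) (k v)) ->
  (forall v, v \in s -> 0 <= E v) ->
  exists e (T : 'M[K]_(n, e)), e%:Z = \sum_(v <- s) E v * (pdeg v)%:Z /\
    forall c, c *m T = 0 -> forall v, v \in s -> vge v (comb iota (w v) c) (k v + E v).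
Proof.
elim: s => [|v s IH] ps wk E0; first by exists 0%N, 0; rewrite big_nil.
have [|||e [T [he hT]]] := IH.
- by move=> u us; apply: ps; rewrite inE us orbT.
- by move=> u i us; apply: wk; rewrite inE us orbT.
- by move=> u us; apply: E0; rewrite inE us orbT.
have vs : v \in v :: s by rewrite inE eqxx.
have pv := ps v vs.
have [T1 [lT1 kT1]] := local_expansion pv (k v) `|E v|%N (pdegP pv).
have wkv i := wk v i vs.
exists (`|E v| * pdeg v + e)%N, (row_mx (\matrix_i T1 (w v i)) T); split.
  by rewrite big_cons -he PoszD PoszM gez0_abs // E0.
move=> c; rewrite mul_mx_row -(row_mx0 _ 1) => /eq_row_mx[c1 c2] u.
rewrite inE => /orP[/eqP ->|us]; last exact: hT.
rewrite -[E v]gez0_abs ?E0 //; apply: kT1.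
  exact: (subspace_comb _ (vge_subspace pv _)).
by rewrite (lin_on_comb _ (vge_subspace pv _) lT1).
Qed.

(** The matrix [T] is the reduction of the functions [u i] modulo [E]. It serves both to bound
    dimensions and as the evaluation map of the code. *)
Lemma LD_conditions n (u : 'I_n -> F) D E (e : nat) :
  (forall i, LD D (u i)) -> (forall v, 0 <= E v) -> hasdeg E e ->
  exists T : 'M[K]_(n, e), forall c, c *m T = 0 ->
    LD (fun v => D v - E v) (comb iota u c).
Proof.
move=> uD E0 [s [[us ps sE] es]].
have [|||e' [T [he hT]]] := @local_conditions n s (fun _ => u) (fun v => - D v) E.
- exact: ps.
- by move=> v i /ps pv; apply: uD.
- by move=> v _; apply: E0.
move: he; rewrite -es => -[ee']; rewrite {e'}ee' in T hT.
exists T => c cT v pv; rewrite opprB addrC.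
have [vs|vs] := boolP (v \in s); first exact: hT.
have /eqP -> : E v == 0 by apply: contraNT vs; apply: sE.
rewrite addr0; exact: (subspace_comb _ (vge_subspace pv _)) (fun i => uD i v pv).
Qed.

Lemma LD_bounded_add D E (e : nat) m : (forall v, 0 <= E v) -> hasdeg E e ->
  bounded iota (LD D) m -> bounded iota (LD (fun v => D v + E v)) (m + e).
Proof.
move=> E0 hE; apply: bounded_ext => [|k u uD]; first exact: LD_subspace.
have [T hT] := LD_conditions uD E0 hE.
by exists T => c /hT; apply: LD_le => v; rewrite addrK.
Qed.

(** * Consequences of the definition of the genus *)

Section Genus.
Variable gg : nat.
Hypothesis hgg : genus iota gg.

Lemma genus_witness : exists D0 d0, hasdeg D0 d0 /\
  exists m, bounded iota (LD D0) m /\ m%:Z = d0 + 1 - gg%:Z.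
Proof.
case: hgg => _ [D [d [m [_ [/divisor_degP hD [[b [_ [_ sb]]] e]]]]]].
exists D, d; split=> //; exists m; split; last by lia.
apply: (@bounded_span _ _ _ _ _ b) => f /LDP /sb[c ->].
by exists (\row_i c i); rewrite comb_row.
Qed.

(** Passing from [D0] to a larger [D] raises the dimension by at most the degree of [D - D0], and
    the genus is attained at [D0]. Together with [riemann] this is the exact dimension of L(D) for
    [D >= D0]. *)
Lemma LD_bounded_large : exists2 D0, exists d0, hasdeg D0 d0 &
  forall D d, hasdeg D d -> (forall v, D0 v <= D v) ->
  exists m, bounded iota (LD D) m /\ m%:Z = d + 1 - gg%:Z.
Proof.
have [D0 [d0 [hD0 [m [bm em]]]]] := genus_witness.
exists D0; first by exists d0.
move=> D d hD le; have hE := hasdegB hD hD0.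
have E0 v : 0 <= D v - D0 v by rewrite subr_ge0.
have dd := hasdeg_ge0 E0 hE.
exists (m + `|d - d0|)%N; split; last by lia.
have -> : D = (fun v => D0 v + (D v - D0 v)) by apply: funext => v; rewrite subrKC.
by apply: LD_bounded_add => //; rewrite gez0_abs.
Qed.

Lemma LD_bounded D d : hasdeg D d -> exists m, bounded iota (LD D) m.
Proof.
move=> hD; have [D0 [d0 hD0] h] := LD_bounded_large.
have [e hE] := hasdeg_max hD hD0.
have [|m [bm _]] := h _ _ hE; first by move=> v; rewrite le_max lexx orbT.
exists m; apply: bounded_sub bm => f; apply: LD_le => v.
by rewrite le_max lexx.
Qed.

Lemma riemann D d : hasdeg D d -> exists m (u : 'I_m -> F),
  [/\ forall i, LD D (u i), indep iota u & d + 1 - gg%:Z <= m%:Z].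
Proof.
move=> hD; have [n /bounded_basis[m [b [_ bD ib sb]]]] := LD_bounded hD.
exists m, b; split=> //.
have [dD ddD] := hasdegP hD.
case: hgg => /(_ D d m dD ddD) + _.
suff h : dim_LD iota D m by move=> /(_ h); lia.
exists b; split=> [i|]; first exact/LDP.
split=> [c cb i|f /LDP /sb[c ->]]; last by exists (c ord0).
have /rowP/(_ i) : \row_j c j = 0 by apply: ib; rewrite comb_row.
by rewrite !mxE.
Qed.

(** Multiplication by [w] embeds L(D) into L(B + D). For a suitable [D] the first has dimension at
    least [deg D + 1 - gg] and the second at most [deg B + deg D + 1 - gg]. *)
Lemma LD_deg_ge0 w B b : w != 0 -> LD B w -> hasdeg B b -> 0 <= b.
Proof.
move=> w0 Bw hB; have [D0 [d0 hD0] h] := LD_bounded_large.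
(* With [D = D0 + max(0, -B)] the sum [B + D] lies above [D0], where the upper bound on dimensions
   is available. *)
have [e hE] := hasdeg_max hasdeg0 (hasdegZ (-1) hB).
have hD := hasdegD hD0 hE.
have [m [u [uD iu um]]] := riemann hD.
have [|n [bn en]] := h _ _ (hasdegD hB hD).
  move=> v; rewrite addrC -addrA lerDl.
  by have := le_max 0 (-1 * B v) (-1 * B v); lia.
have mn : (m <= n)%N.
  apply: bn (indep_mul w0 iu) => i; exact: LDM.
lia.
Qed.

(** The divisor [div f + D], cut to 0 at functions that are not places. *)
Definition zeros (f : F) (D : div) : div :=
  fun v => if pselect (is_place iota v) then v f + D v else 0.

Lemma size_le_sum_pdeg (s : seq place) : (forall v, v \in s -> is_place iota v) ->
  (size s)%:Z <= \sum_(v <- s) (pdeg v)%:Z.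
Proof.
elim: s => [|v s IH] ps; first by rewrite big_nil.
rewrite big_cons /=.
rewrite -add1n PoszD lerD //; first by rewrite lez_nat pdeg_gt0 //; apply: ps; apply: mem_head.
by apply: IH => u us; apply: ps; rewrite inE us orbT.
Qed.

Lemma zerosE f D v : is_place iota v -> zeros f D v = v f + D v.
Proof. by rewrite /zeros; case: pselect. Qed.

Lemma zeros_ge0 f D v : f != 0 -> LD D f -> 0 <= zeros f D v.
Proof.
move=> f0 Df; rewrite /zeros; case: pselect => // pv.
by have := Df v pv; rewrite /vge (negbTE f0) /=; lia.
Qed.

(** In substance, principal divisors have degree 0. The support is finite, because [|d| + 1] places
    in it would put [f] in a Riemann-Roch space of negative degree. Then [LD_deg_ge0], applied to
    [f^-1] and to [f], gives the two inequalities. *)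
Lemma hasdeg_zeros f D d : f != 0 -> LD D f -> hasdeg D d -> hasdeg (zeros f D) d.
Proof.
move=> f0 Df hD.
have z0 v := zeros_ge0 v f0 Df.
have [S [[us ps] mx]] : exists s,
    (uniq s /\ forall v, v \in s -> is_place iota v /\ zeros f D v != 0) /\
    forall v, zeros f D v != 0 -> v \in s.
  apply: contrapT => nS.
  have H n : exists s, [/\ uniq s, size s = n &
      forall v, v \in s -> is_place iota v /\ zeros f D v != 0].
    elim: n => [|n [s [us ss hs]]]; first by exists [::].
    have [v vs vz] : exists2 v, v \notin s & zeros f D v != 0.
      apply: contrapT => nv; apply: nS; exists s; split=> // v vz.
      by apply: contrapT => /negP vs; apply: nv; exists v.
    exists (v :: s); split=> /=; rewrite ?vs ?ss // => u.
    rewrite inE => /orP[/eqP -> {u}|/hs //]; split=> //.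
    by move: vz; rewrite /zeros; case: pselect => // ; rewrite eqxx.
  have [s [us ss hs]] := H `|d|.+1.
  pose E : div := fun v => (v \in s)%:R.
  have hE : hasdeg E (\sum_(v <- s) (pdeg v)%:Z).
    exists s; split; first by split=> // [v /hs[]|v] //; rewrite /E; case: (v \in s); rewrite ?eqxx.
    by rewrite !big_seq; apply: eq_bigr => v vs; rewrite /E vs mul1r.
  have /LD_deg_ge0 : LD (fun v => D v - E v) f.
    move=> v pv; rewrite /vge (negbTE f0) /= /E.
    have zE := zerosE f D pv.
    have := z0 v; rewrite zE; case vs: (v \in s) => /=; last by lia.
    by have [_] := hs v vs; rewrite zE; lia.
  move=> /(_ _ f0 (hasdegB hD hE)).
  have : (size s)%:Z <= \sum_(v <- s) (pdeg v)%:Z.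
    by apply: size_le_sum_pdeg => v /hs[].
  rewrite ss; lia.
have cS : carries S (zeros f D) by split=> // v /ps[].
pose e := \sum_(v <- S) zeros f D v * (pdeg v)%:Z.
have hE : hasdeg (zeros f D) e by exists S.
suff -> : d = e by [].
apply/eqP; rewrite eq_le -(subr_ge0 d) -(subr_ge0 e); apply/andP; split.
  apply: (@LD_deg_ge0 f^-1 _ _ _ _ (hasdegB hE hD)); rewrite ?invr_eq0 //.
  by move=> v pv; rewrite /vge (placeV pv) zerosE //; apply/orP; right; lia.
apply: (@LD_deg_ge0 f _ _ f0 _ (hasdegB hD hE)) => v pv.
by rewrite /vge zerosE //; apply/orP; right; lia.
Qed.

(** All powers of [f] lie in the finite-dimensional space L(0), so [f] is algebraic over [K]. *)
Lemma LD0_const f : (forall z, algebraic iota z -> exists c, z = iota c) ->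
  LD (fun _ => 0) f -> exists c, f = iota c.
Proof.
move=> alg f0; have [m bm] := LD_bounded hasdeg0.
pose u (i : 'I_m.+1) := f ^+ i.
have u0 i : LD (fun _ => 0) (u i).
  by move=> v pv; rewrite oppr0 -(mul0rn _ i); apply: (vgeX pv); have := f0 v pv; rewrite oppr0.
have [|iu] := pselect (indep iota u).
  by move=> /(bm _ _ u0); rewrite ltnn.
apply: alg.
have [c [cu c0]] : exists c, comb iota u c = 0 /\ c <> 0.
  apply: contrapT => nc; apply: iu => c cu; apply: contrapT => c0; apply: nc.
  by exists c.
exists (rVpoly c).
  by apply/eqP => /(congr1 (@poly_rV K m.+1)); rewrite rVpolyK linear0.
rewrite -[RHS]cu (@horner_coef_wide _ m.+1); last by rewrite size_map_poly size_poly.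
by apply: eq_bigr => i _; rewrite coef_map coef_rVpoly_ord.
Qed.
End Genus.
End Divisors.

(** * Residue fields *)

Section ResidueField.
Variables (K : finFieldType) (F : fieldType) (iota : {rmorphism K -> F}).
Variables (v : F -> int) (pv : is_place iota v) (d : nat) (b : 'I_d -> F).
Variable hb : residue_basis iota v b.

(** Elements are coordinate vectors in the basis [b]. The abstraction keeps the proof [hb] in the
    type, so that a product computed on lifts to [F] can be attached to it as a field structure. *)
Definition residue_field : Type := (fun _ : residue_basis iota v b => 'rV[K]_d) hb.
Local Notation R := residue_field.

HB.instance Definition _ := Finite.on R.
HB.instance Definition _ := GRing.Zmodule.on R.

Definition rlift (x : R) : F := comb iota b x.

Lemma rlift_ge0 x : vge v (rlift x) 0.
Proof. by case: hb => b0 _ _; apply: (subspace_comb _ (vge_subspace pv 0)). Qed.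

Lemma residue_ex z : exists c : R, vge v z 0 -> vge v (z - rlift c) 1.
Proof.
have [z0|z0] := pselect (vge v z 0); last by exists 0.
by case: hb => _ _ /(_ z z0)[c hc]; exists c.
Qed.

Definition residue z : R := projT1 (cid (residue_ex z)).

Lemma residueP z : vge v z 0 -> vge v (z - rlift (residue z)) 1.
Proof. by rewrite /residue; case: cid. Qed.

Lemma rliftB x y : rlift (x - y) = rlift x - rlift y.
Proof. by rewrite /rlift addrC -scaleN1r combP rmorphN1 mulN1r addrC. Qed.

Lemma rlift_inj x y : vge v (rlift x - rlift y) 1 -> x = y.
Proof.
rewrite -rliftB; case: hb => _ ib _ /ib /eqP.
by rewrite subr_eq0 => /eqP.
Qed.

Lemma residue_eq z x : vge v z 0 -> vge v (z - rlift x) 1 -> residue z = x.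
Proof.
move=> z0 zx; apply: rlift_inj.
rewrite -[X in vge v X 1](_ : (z - rlift x) - (z - rlift (residue z)) = _); last by ring.
by rewrite (vgeB pv) ?residueP.
Qed.

Lemma rliftK x : residue (rlift x) = x.
Proof. by apply: residue_eq; rewrite ?rlift_ge0 // subrr vge0. Qed.

Definition res_mul (x y : R) : R := residue (rlift x * rlift y).
Definition res_one : R := residue 1.
Definition res_inv (x : R) : R := if x == 0 then 0 else residue (rlift x)^-1.

Lemma vgeM0 x y : vge v x 0 -> vge v y 0 -> vge v (x * y) 0.
Proof. by move=> x0 y0; rewrite -[0]addr0 (vgeM pv). Qed.

Lemma residueD y z : vge v y 0 -> vge v z 0 -> residue (y + z) = residue y + residue z.
Proof.
move=> y0 z0; apply: residue_eq; first by rewrite (vgeD pv).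
have -> : rlift (residue y + residue z) = rlift (residue y) + rlift (residue z).
  by have := rliftB (residue y + residue z) (residue z); rewrite addrK => ->; ring.
by rewrite opprD addrACA (vgeD pv) ?residueP.
Qed.

Lemma residueM y z : vge v y 0 -> vge v z 0 ->
  residue (y * z) = res_mul (residue y) (residue z).
Proof.
move=> y0 z0; apply: residue_eq; first exact: vgeM0.
have h := residueP (vgeM0 (rlift_ge0 (residue y)) (rlift_ge0 (residue z))).
rewrite -[X in vge v X 1](_ : (y - rlift (residue y)) * z +
  (rlift (residue y) * (z - rlift (residue z)) +
  (rlift (residue y) * rlift (residue z) -
   rlift (res_mul (residue y) (residue z)))) = _); last by ring.
apply: (vgeD pv); first by rewrite -[1]addr0 (vgeM pv) ?residueP.
by apply: (vgeD pv) => //; rewrite -[1]add0r (vgeM pv) ?residueP ?rlift_ge0.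
Qed.

Lemma vge10 : vge v 1 0. Proof. exact: (vge1 pv). Qed.
#[local] Hint Resolve rlift_ge0 vgeM0 vge10 : core.

Lemma res_mulA : associative res_mul.
Proof.
move=> x y z; rewrite -[x in LHS]rliftK -[z in RHS]rliftK -!residueM ?vgeM0 //.
by rewrite mulrA.
Qed.

Lemma res_mulC : commutative res_mul.
Proof. by move=> x y; rewrite /res_mul mulrC. Qed.

Lemma res_mul1 : left_id res_one res_mul.
Proof.
by move=> x; rewrite -{1}[x]rliftK /res_one -residueM // mul1r rliftK.
Qed.

Lemma res_mulDl : left_distributive res_mul +%R.
Proof.
move=> x y z; rewrite -[x]rliftK -[y]rliftK -[z]rliftK -residueD // -!residueM //.
  by rewrite mulrDl residueD ?vgeM0.
by rewrite (vgeD pv).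
Qed.

Lemma residue0 : residue 0 = 0.
Proof. by rewrite -[RHS]rliftK /rlift comb0. Qed.

Lemma res_one_neq0 : res_one != 0.
Proof.
apply/eqP => h; have := residueP vge10; rewrite -/res_one h /rlift comb0 subr0.
by rewrite /vge oner_eq0 (place1 pv).
Qed.

HB.instance Definition _ := GRing.Zmodule_isComNzRing.Build R
  res_mulA res_mulC res_mul1 res_mulDl res_one_neq0.

Lemma rlift_unit x : x != 0 -> rlift x != 0 /\ v (rlift x) = 0.
Proof.
move=> x0; have hx : ~~ vge v (rlift x) 1.
  apply: contraNN x0 => hx; apply/eqP/rlift_inj.
  by rewrite /rlift comb0 subr0.
have lx : rlift x != 0 by apply: contraNneq hx => ->; rewrite vge0.
split=> //; have := rlift_ge0 x; move: hx; rewrite /vge (negbTE lx) /=; lia.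
Qed.

Lemma res_mulV : forall x : R, x != 0 -> res_inv x * x = 1.
Proof.
move=> x x0; rewrite /res_inv (negbTE x0); have [lx vx] := rlift_unit x0.
rewrite -{2}[x]rliftK -[LHS]residueM //; first by rewrite mulVf.
by rewrite /vge (placeV pv) vx oppr0 lexx orbT.
Qed.

Lemma res_inv0 : res_inv 0 = 0.
Proof. by rewrite /res_inv eqxx. Qed.

HB.instance Definition _ := GRing.ComNzRing_isField.Build R res_mulV res_inv0.

Lemma card_residue_field : #|{: R}| = (#|K| ^ d)%N.
Proof. by rewrite card_mx mul1n. Qed.

Definition res_const (c : K) : R := residue (iota c).

Fact res_const_zmod : zmod_morphism res_const.
Proof.
move=> x y; rewrite /res_const; apply/eqP; rewrite eq_sym subr_eq -residueD.
- by rewrite -rmorphD subrK.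
- exact: (vge_const pv).
- exact: (vge_const pv).
Qed.

Fact res_const_monoid : monoid_morphism res_const.
Proof.
split; first by rewrite /res_const rmorph1.
by move=> x y; rewrite /res_const rmorphM residueM ?(vge_const pv).
Qed.

HB.instance Definition _ := GRing.isZmodMorphism.Build K R res_const res_const_zmod.
HB.instance Definition _ := GRing.isMonoidMorphism.Build K R res_const res_const_monoid.

Lemma residue_horner (p : {poly K}) z : vge v z 0 ->
  residue (map_poly iota p).[z] = (map_poly res_const p).[residue z].
Proof.
move=> z0; elim/poly_ind: p => [|p c IH]; first by rewrite !rmorph0 !horner0 residue0.
rewrite !rmorphD !rmorphM /= !map_polyX !map_polyC !hornerE residueD ?residueM ?IH //.
- exact: (vge_horner pv).
- by apply: vgeM0 => //; apply: (vge_horner pv).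
- exact: (vge_const pv).
Qed.

(** The residue field has [#|K| ^ d] elements, so ['X^(#|K| ^ d) - 'X] splits there into linear
    factors, and so does its divisor [p]. *)
Lemma residue_root (p : {poly K}) : (1 < size p)%N -> p %| 'X^(#|K| ^ d) - 'X ->
  exists2 z, vge v z 0 & vge v (map_poly iota p).[z] 1.
Proof.
move=> sp pd.
pose L : finFieldType := HB.pack_for finFieldType R.
have hp : map_poly res_const p %| \prod_(x : L) ('X - x%:P).
  rewrite -finField_genPoly card_residue_field.
  rewrite -(map_polyXn res_const) -[X in _ - X](map_polyX res_const) -rmorphB.
  by rewrite dvdp_map.
have [m hm] := dvdp_prod_XsubC hp.
have [x rx] : exists x : L, root (map_poly res_const p) x.
  move: hm; case: (mask m _) => [|x s] hm; last first.
    by exists x; rewrite (eqp_root hm) big_cons rootM root_XsubC eqxx.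
  by move: sp; rewrite -(size_map_poly res_const) (eqp_size hm) big_nil size_poly1.
exists (rlift x) => //.
have := residueP (vge_horner pv p (rlift_ge0 x)).
by rewrite residue_horner // rliftK (rootP rx) /rlift comb0 subr0.
Qed.
End ResidueField.

(** * Constant field extensions *)

Section FiniteFieldPolynomials.
Variable K : finFieldType.
Local Notation q := #|K|.

Lemma card_pnat : exists2 p, p \in [pchar K] & p.-nat q.
Proof.
have [p pr_p pK] := finPcharP K; exists p => //.
have := pprimeChar_pgroup pK.
by rewrite /pgroup cardsT.
Qed.

Lemma card_natr0 n : (0 < n)%N -> (q ^ n)%:R = 0 :> K.
Proof.
move=> n0; rewrite natrX; suff -> : q%:R = 0 :> K by rewrite expr0n gtn_eqF.
rewrite -[LHS](FinRing.Theory.zmodXgE q (1 : K)) -cardsT.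
by rewrite expg_cardG ?inE.
Qed.

Lemma expf_cardX n (x : K) : x ^+ (q ^ n) = x.
Proof. by elim: n => [|n IH]; rewrite ?expn0 ?expr1 // expnSr exprM IH expf_card. Qed.

Lemma dvdp_XnX (R : fieldType) N k :
  ('X^N - 'X : {poly R}) %| 'X^(N ^ k) - 'X.
Proof.
elim: k => [|k IH]; first by rewrite expn0 expr1 subrr dvdp0.
have -> : 'X^(N ^ k.+1) - 'X = ('X^(N ^ k)) ^+ N - 'X ^+ N + ('X^N - 'X) :> {poly R}.
  by rewrite -exprM -expnSr addrA subrK.
by rewrite dvdp_addr // subrXX dvdp_mulr.
Qed.

Lemma irreducible_factor (R : fieldType) (p : {poly R}) : (1 < size p)%N ->
  exists2 r, irreducible_poly r & r %| p.
Proof.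
move=> sp; pose P n := `[< exists r : {poly R}, [/\ size r = n, (1 < size r)%N & r %| p] >].
have [|n /asboolP[r [sr r1 rp]] mn] := @ex_minnP P.
  by exists (size p); apply/asboolP; exists p.
exists r => //; split=> // s s1 sr'.
have r0 : r != 0 by rewrite -size_poly_gt0; lia.
have s0 : s != 0 by apply: dvdpN0 sr' r0.
rewrite -dvdp_size_eqp // eqn_leq dvdp_leq //= sr; apply: mn.
apply/asboolP; exists s; split=> //; last exact: dvdp_trans rp.
by rewrite ltn_neqAle eq_sym s1 size_poly_gt0.
Qed.

(** An irreducible factor of the quotient of ['X^(q ^ l) - 'X] by ['X^q - 'X]. If it were linear,
    its root in [K] would be a double root of ['X^(q ^ l) - 'X], whose derivative is [-1]. *)
Lemma exists_nonlinear_irreducible l : (1 < l)%N ->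
  exists phi : {poly K}, [/\ irreducible_poly phi, (2 < size phi)%N &
    phi %| 'X^(q ^ l) - 'X].
Proof.
move=> l1; have q1 : (1 < q)%N := finNzRing_gt1 K.
have ql : (q < q ^ l)%N by rewrite -[X in (X < _)%N]expn1 ltn_exp2l.
have size_XX n : (1 < n)%N -> size ('X^n - 'X : {poly K}) = n.+1.
  by move=> n1; rewrite size_polyDl size_polyXn // size_polyN size_polyX.
have d1 : ('X^q - 'X : {poly K}) %| 'X^(q ^ l) - 'X.
  exact: dvdp_XnX.
pose Q := ('X^(q ^ l) - 'X : {poly K}) %/ ('X^q - 'X).
have QE : 'X^(q ^ l) - 'X = Q * ('X^q - 'X) by rewrite divpK.
have X0 : 'X^q - 'X != 0 :> {poly K} by rewrite -size_poly_gt0 size_XX.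
have Q0 : Q != 0.
  apply/eqP => Qz; have := size_XX (q ^ l)%N (ltn_trans q1 ql).
  by rewrite QE Qz mul0r size_poly0.
have sQ : (1 < size Q)%N.
  have := size_XX (q ^ l)%N (ltn_trans q1 ql).
  rewrite QE size_mul // size_XX // addnS /= => e.
  by rewrite -(ltn_add2r q) e add1n ltnS.
have [phi irr pQ] := irreducible_factor sQ.
exists phi; split=> //; last by rewrite QE dvdp_mulr.
rewrite ltn_neqAle (irr.1) andbT; apply/eqP => s2.
have [c rc] := poly2_root (esym s2).
have rQ : root Q c by move: rc; rewrite -!dvdp_XsubCl => /dvdp_trans; apply.
have rX : root ('X^q - 'X) c by rewrite rootE !hornerE expf_card subrr.
have := congr1 (fun p => p^`().[c]) QE.
rewrite /= derivM derivB derivXn derivX hornerD hornerN hornerMn hornerXn hornerC.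
rewrite -mulr_natr card_natr0 ?mulr0; last by lia.
rewrite !hornerD !hornerM (rootP rQ) (rootP rX) mulr0 mul0r addr0 sub0r.
by move/eqP; rewrite oppr_eq0 oner_eq0.
Qed.
End FiniteFieldPolynomials.

Section ConstantExtension.
Variables (K : finFieldType) (F : fieldType) (iota : {rmorphism K -> F}).
Hypothesis alg_closed : forall z, algebraic iota z -> exists c, z = iota c.

(** Raising the coefficients of [g] to the power [Q] gives a polynomial [h] congruent to [g ^+ Q]
    modulo ['X^Q - 'X], hence divisible by [g]. Size and leading coefficient then force [g = h]:
    every coefficient satisfies [c ^+ Q = c], is algebraic over [K], and so lies in [K]. *)
Lemma monic_dvdp_const l (g : {poly F}) : (0 < l)%N ->
  g \is monic -> g %| 'X^(#|K| ^ l) - 'X -> exists g0, g = map_poly iota g0.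
Proof.
move=> l0 mg; set Q := (_ ^ l)%N => gX.
have [p pK] := card_pnat K; have pF : p \in [pchar F] by rewrite (fmorph_pchar iota).
have pP : p \in [pchar {poly F}] by rewrite pchar_poly.
move=> pq; have pQ : p.-nat Q by rewrite pnatX pq.
have Q1 : (1 < Q)%N.
  apply: leq_trans (finNzRing_gt1 K) _.
  by rewrite -[X in (X <= _)%N]expn1 leq_exp2l // finNzRing_gt1.
pose h := \poly_(i < size g) (g`_i ^+ Q).
have hsum : h = \sum_(i < size g) (g`_i ^+ Q)%:P * 'X^i.
  by rewrite /h poly_def; apply: eq_bigr => i _; rewrite mul_polyC.
have gQ : g ^+ Q = \sum_(i < size g) (g`_i ^+ Q)%:P * 'X^i ^+ Q.
  rewrite -{1}[g]coefK poly_def.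
  elim/big_ind2: _ => [|x y x' y' <- <-|i _]; first by rewrite expr0n gtn_eqF //; lia.
    by rewrite exprDn_pchar // (eq_pnat _ (pcharf_eq pP)).
  by rewrite -mul_polyC exprMn rmorphXn.
have gh : g %| h.
  have -> : h = g ^+ Q - (g ^+ Q - h) by rewrite subKr.
  apply: dvdp_sub; first by rewrite dvdp_exp //; lia.
  rewrite gQ hsum -sumrB; apply: (big_ind (fun x => g %| x)) => [||i _]; rewrite ?dvdp0 //.
    by move=> x y; apply: dvdp_add.
  rewrite -mulrBr dvdp_mull // -exprM mulnC exprM subrXX dvdp_mulr //.
have lg : g`_(size g).-1 = 1 by have /monicP := mg.
have g0 : g != 0 := monic_neq0 mg.
have gh' : g = h.
  apply/eqP; rewrite eq_sym -subr_eq0; apply/eqP; apply: contraTeq (gh) => hg.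
  have : ~~ (g %| h - g).
    rewrite gtNdvdp //.
    have sg : (0 < size g)%N by rewrite size_poly_gt0.
    rewrite -(prednK sg) ltnS; apply/leq_sizeP => j; rewrite leq_eqVlt coefB coef_poly.
    case/orP => [/eqP <-|]; first by rewrite lg prednK // leqnn expr1n subrr.
    by rewrite prednK // => sj; rewrite ltnNge sj nth_default // subrr.
  by apply: contraNN => gh2; rewrite dvdp_sub.
have [c hc] : exists c : nat -> K, forall i, g`_i = iota (c i).
  suff /choice[c hc] : forall i, exists c, g`_i = iota c by exists c.
  move=> i; apply: alg_closed; exists ('X^Q - 'X).
    by rewrite -size_poly_gt0 size_polyDl size_polyXn // size_polyN size_polyX.
  rewrite rmorphB /= map_polyXn map_polyX !hornerE.
  have := congr1 (fun p : {poly F} => p`_i) gh'; rewrite /= coef_poly.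
  case: ltnP => [_ <-|/(nth_default 0) ->]; first by rewrite subrr.
  by rewrite expr0n gtn_eqF ?subrr //; lia.
exists (\poly_(i < size g) c i); apply/polyP => i; rewrite coef_map coef_poly.
by case: ltnP => [_|/(nth_default 0) ->]; rewrite ?hc /= ?rmorph0.
Qed.

(** A factor over [F], made monic, already has its coefficients in [K] by [monic_dvdp_const], so it
    is a factor of [phi] over [K]. *)
Lemma irreducible_const_ext l (phi : {poly K}) : (0 < l)%N -> irreducible_poly phi ->
  phi %| 'X^(#|K| ^ l) - 'X -> irreducible_poly (map_poly iota phi).
Proof.
move=> l0 [s1 irr] pX; split=> [|g sg gp]; first by rewrite size_map_poly.
have phi0 : phi != 0 by rewrite -size_poly_gt0 ltnW.
have g0 : g != 0 by apply: dvdpN0 gp _; rewrite map_poly_eq0.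
have lg : lead_coef g != 0 by rewrite lead_coef_eq0.
pose g1 := (lead_coef g)^-1 *: g.
have gg1 : g1 %= g by rewrite eqp_scale ?invr_eq0.
have mg1 : g1 \is monic by rewrite monicE lead_coefZ mulVf.
have [|g2 hg2] := monic_dvdp_const l0 mg1.
  rewrite (eqp_dvdl _ gg1); apply: dvdp_trans gp _.
  by rewrite -(map_polyXn iota) -[X in _ - X](map_polyX iota) -rmorphB dvdp_map.
have : g2 %= phi.
  apply: irr; last by rewrite -(dvdp_map iota) -hg2 (eqp_dvdl _ gg1).
  by rewrite -(size_map_poly iota) -hg2 (eqp_size gg1).
by rewrite -(eqp_map iota) -hg2 => /(eqp_trans _); apply; rewrite eqp_sym.
Qed.
End ConstantExtension.

(** * The norm *)

Section Norm.
Variables (K F : fieldType) (iota : {rmorphism K -> F}).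
Local Notation ev p x := ((map_poly iota p).[x]).

(** Every term of the Leibniz formula contains exactly one entry of each column. *)
Lemma vge_det v n (A : 'M[F]_n) (k : 'I_n -> int) : is_place iota v ->
  (forall i j, vge v (A i j) (k j)) -> vge v (\det A) (\sum_j k j).
Proof.
move=> pv Ak; apply: (vge_sum pv) => s _.
rewrite -[X in vge _ _ X]add0r (vgeM pv) //.
  by case: (odd_perm s); rewrite ?expr1 ?expr0 ?(vgeN pv) (vge1 pv).
rewrite [X in vge _ _ X](reindex_inj (@perm_inj _ s)) /=.
by apply: (vge_prod pv) => i _.
Qed.

Variables (phi : {poly K}) (e' : nat).
Local Notation e := (2 + e')%N.
Hypothesis sphi : size phi = e.+1.
Hypothesis irr : irreducible_poly (map_poly iota phi).

(* Multiplication by [\sum_k f_k 'X^k] on [F['X] / phi]. *)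
Definition mulphi_mx (f : 'I_e -> F) : 'M[F]_e :=
  \matrix_(i, j) \sum_(k < e) f k * iota (('X^(i + k) %% phi)`_j).

Lemma irreducible_dvdpM (R : fieldType) (p a b : {poly R}) : irreducible_poly p ->
  p %| a * b -> (p %| a) || (p %| b).
Proof.
move=> [sp ip] pab; have [//|npa] := boolP (p %| a).
rewrite -(Gauss_dvdpr _ (_ : coprimep p a)) //.
rewrite /coprimep; apply: contraNT npa => sg.
by have := ip _ sg (dvdp_gcdl _ _) => /eqp_dvdl <-; apply: dvdp_gcdr.
Qed.

Lemma modp_sum (R : fieldType) (p : {poly R}) (I : Type) (r : seq I) (P : pred I)
    (G : I -> {poly R}) :
  (\sum_(i <- r | P i) G i) %% p = \sum_(i <- r | P i) (G i %% p).
Proof. exact: (big_morph (fun a => a %% p) (modpD p) (mod0p p)). Qed.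

(** A kernel vector, read as a polynomial, has a product with [f] divisible by [phi]. Both factors
    are nonzero of degree less than that of the irreducible [phi]. *)
Lemma det_mulphi_neq0 f : (exists k, f k != 0) -> \det (mulphi_mx f) != 0.
Proof.
move=> [k0 fk0]; apply/negP => /det0P[c c0 cA].
pose fp : {poly F} := \poly_(k < e) (if insub k is Some k' then f k' else 0).
pose ff : 'rV[F]_e := \row_k f k.
have sphiF : size (map_poly iota phi) = e.+1 by rewrite size_map_poly.
have nz (x : 'rV[F]_e) : x != 0 -> ~~ (map_poly iota phi %| rVpoly x).
  move=> x0; rewrite gtNdvdp ?sphiF ?ltnS ?size_poly //.
  by apply: contraNneq x0 => /(congr1 (@poly_rV F e)); rewrite rVpolyK linear0 => ->.
have : map_poly iota phi %| rVpoly c * rVpoly ff.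
  apply/modp_eq0P.
  have cE (x : 'rV[F]_e) : rVpoly x = \sum_(i < e) x 0 i *: 'X^i.
    rewrite /rVpoly poly_def; apply: eq_bigr => i _.
    by rewrite valK.
  rewrite !cE mulr_suml.
  under eq_bigr do rewrite mulr_sumr.
  rewrite modp_sum; under eq_bigr do rewrite modp_sum.
  apply/polyP => j; rewrite coef0 coef_sum.
  under eq_bigr do rewrite coef_sum.
  have [je|je] := ltnP j e; last first.
    rewrite big1 // => i _; rewrite big1 // => k _.
    rewrite nth_default // (leq_trans _ je) // -ltnS -sphiF ltn_modp.
    by rewrite -size_poly_gt0 sphiF.
  have /rowP/(_ (Ordinal je)) := cA; rewrite !mxE => h; rewrite -[RHS]h.
  apply: eq_bigr => i _; rewrite mxE mulr_sumr; apply: eq_bigr => k _.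
  rewrite -scalerAl -scalerAr scalerA modpZl coefZ mxE mulrA; congr (_ * _).
  by rewrite -exprD -(map_polyXn iota) -map_modp coef_map.
move/(irreducible_dvdpM irr); rewrite (negbTE (nz _ c0)) (negbTE (nz _ _)) //.
by apply: contraNneq fk0 => /rowP/(_ k0); rewrite !mxE => ->.
Qed.

Lemma ev_div_mod m x : ev ('X^m %% phi) x = x ^+ m - ev phi x * ev ('X^m %/ phi) x.
Proof.
have -> : x ^+ m = ev ('X^m %/ phi * phi + 'X^m %% phi) x.
  by rewrite -divp_eq map_polyXn hornerXn.
rewrite rmorphD rmorphM hornerD hornerM /=; ring.
Qed.

Lemma mulphi_mx_eval f i x : \sum_j mulphi_mx f i j * x ^+ j =
  x ^+ i * (\sum_k f k * x ^+ k) -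
  ev phi x * \sum_k f k * ev ('X^(i + k) %/ phi) x.
Proof.
under eq_bigr do rewrite mxE mulr_suml.
rewrite exchange_big /= !mulr_sumr -sumrB; apply: eq_bigr => k _.
rewrite mulrCA -exprD mulrCA -mulrBr -ev_div_mod.
rewrite (@horner_coef_wide _ e); last first.
  by rewrite size_map_poly -ltnS -sphi ltn_modp -size_poly_gt0 sphi.
by rewrite mulr_sumr; apply: eq_bigr => j _; rewrite coef_map mulrA.
Qed.

(* Modulo [phi x1] and [phi x2], the columns [x1 ^ i] and [x2 ^ i] are eigenvectors of the
multiplication matrix, with eigenvalues [f x1] and [f x2]; the matrix [U] contains them. *)
Lemma vge_det_mulphi v (f : 'I_e -> F) x1 x2 (d e1 e2 M : int) : is_place iota v ->
  (forall k, vge v (f k) (- d)) -> vge v x1 0 -> vge v x2 0 ->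
  vge v (ev phi x1) M -> vge v (ev phi x2) M -> x2 - x1 != 0 -> v (x2 - x1) = 0 ->
  0 <= e1 <= M -> 0 <= e2 <= M ->
  vge v (\sum_(k < e) f k * x1 ^+ k) (e1 - d) -> vge v (\sum_(k < e) f k * x2 ^+ k) (e2 - d) ->
  vge v (\det (mulphi_mx f)) (e1 + e2 - d *+ e).
Proof.
move=> pv fd x10 x20 px1 px2 nx vx /andP[e10 e1M] /andP[e20 e2M] fx1 fx2.
pose A := mulphi_mx f.
have XX (x : F) i : vge v x 0 -> vge v (x ^+ i) 0.
  by move=> x0; rewrite -(mul0rn _ i) (vgeX pv).
have colx x e0 i : vge v x 0 -> vge v (ev phi x) M -> 0 <= e0 <= M ->
    vge v (\sum_(k < e) f k * x ^+ k) (e0 - d) -> vge v (\sum_j A i j * x ^+ j) (e0 - d).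
  move=> x0 px /andP[e00 e0M] fx; rewrite mulphi_mx_eval (vgeB pv) //.
    by rewrite -[_ - _]add0r (vgeM pv) ?XX.
  apply: (@vge_le _ _ _ (M - d)); first by rewrite lerD2r.
  apply: (vgeM pv) => //; apply: (vge_sum pv) => k _.
  by rewrite -[- d]addr0 (vgeM pv) // (vge_horner pv).
(* The identity matrix with its first two columns replaced by the powers of [x1] and [x2]. Its
   determinant is the Vandermonde determinant [x2 - x1], of value 0, so multiplying by [U] leaves
   the value of the norm unchanged. *)
pose U : 'M[F]_e := block_mx
  (\matrix_(i, j) (if j == 0 then x1 else x2) ^+ i) 0
  (\matrix_(i, j) (if j == 0 then x1 else x2) ^+ (2 + i)) 1%:M.
have detU : \det U = x2 - x1.
  rewrite det_lblock det1 mulr1 (expand_det_row _ 0) !big_ord_recl big_ord0.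
  by rewrite /cofactor !det_mx11 !mxE /=; ring.
have AU i j : vge v ((A *m U) i j)
    (if j == 0 then e1 - d else if j == 1 then e2 - d else - d).
  have Al (j' : 'I_2) : (A *m U) i (lshift e' j') =
      \sum_j A i j * (if j' == 0 then x1 else x2) ^+ j.
    rewrite mxE; apply: eq_bigr => l _; congr (_ * _).
    rewrite /U -[l]splitK; case: (split l) => l' /=.
      by rewrite block_mxEul mxE.
    by rewrite block_mxEdl mxE.
  have Ar (j' : 'I_e') : (A *m U) i (rshift 2 j') = A i (rshift 2 j').
    rewrite mxE (bigD1 (rshift 2 j')) //= /U block_mxEdr [1%:M _ _]mxE eqxx mulr1.
    rewrite big1 ?addr0 // => l; rewrite -[l]splitK; case: (split l) => l' /= ll.
      by rewrite block_mxEur [X in _ * X]mxE mulr0.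
    move: ll; rewrite (inj_eq (@rshift_inj _ _)) block_mxEdr [1%:M _ _]mxE => /negbTE ->.
    by rewrite mulr0.
  rewrite -[j]splitK; case: (split j) => j' /=.
    rewrite Al; case: j' => -[|[|//]] lj /=.
      by apply: colx; rewrite ?e10.
    by apply: colx; rewrite ?e20.
  rewrite Ar mxE; apply: (vge_sum pv) => k _.
  by rewrite -[- d]addr0 (vgeM pv) // (vge_const pv).
have := vge_det pv AU; rewrite det_mulmx detU.
rewrite !big_ord_recl /= sumr_const card_ord.
move=> h.
rewrite -(mulfK nx (\det _)) -(vge_div pv _ _ nx vx) addr0.
suff -> : e1 + e2 - d *+ e = e1 - d + (e2 - d + - d *+ e') by [].
by rewrite mulrnDr mulNrn; ring.
Qed.
End Norm.

(** * F. K. Schmidt's theorem *)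

Section DivisorCounting.
Variables (K : finFieldType) (F : fieldType) (iota : {rmorphism K -> F}).
Local Notation place := (F -> int).
Local Notation div := (place -> int).
Local Notation q := #|K|.
Local Notation ev p x := ((map_poly iota p).[x]).
Local Notation hasdeg := (hasdeg iota).
Local Notation LD := (LD iota).
Local Notation pdeg := (pdeg iota).
Hypothesis place_degE : forall v, is_place iota v -> exists d, place_deg iota v d.
Variable gg : nat.
Hypothesis hgg : genus iota gg.
Hypothesis alg_closed : forall z, algebraic iota z -> exists c, z = iota c.

Lemma ev_expq (p : {poly K}) x n : ev p (x ^+ (q ^ n)) = (ev p x) ^+ (q ^ n).
Proof.
have [p' pK pq] := card_pnat K.
have pF : p' \in [pchar F] by rewrite (fmorph_pchar iota).
have pQ : p'.-nat (q ^ n)%N by rewrite pnatX pq.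
elim/poly_ind: p => [|p c IH].
  by rewrite rmorph0 !horner0 expr0n gtn_eqF // expn_gt0 ltnW // finNzRing_gt1.
rewrite !rmorphD !rmorphM /= !map_polyX !map_polyC !hornerE.
rewrite exprDn_pchar //; last by rewrite (eq_pnat _ (pcharf_eq pF)).
by rewrite exprMn IH -rmorphXn /= expf_cardX.
Qed.

(** Factor [b ^+ q - b] as the product of the [b - iota c] for [c] in [K]. A factor of positive
    value would make [c] a root of [phi], which is irreducible and not linear. *)
Lemma val_Frobenius_sub v (phi : {poly K}) b : is_place iota v ->
  irreducible_poly phi -> (2 < size phi)%N -> vge v b 0 -> vge v (ev phi b) 1 ->
  b ^+ q - b != 0 /\ v (b ^+ q - b) = 0.
Proof.
move=> pv irr sphi b0 pb.
have hc c : b - iota c != 0 /\ v (b - iota c) = 0.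
  have nr : phi.[c] != 0.
    apply: contraTneq sphi => /eqP; rewrite -/(root phi c) -dvdp_XsubCl => /irr.2.
    by rewrite size_XsubC => /(_ isT) /eqp_size <-; rewrite size_XsubC.
  have n1 : ~~ vge v (b - iota c) 1.
    apply: contraNN nr => bc.
    have /factor_theorem[r hr] : root (phi - (phi.[c])%:P) c.
      by rewrite rootE !hornerE subrr.
    have pE : ev phi b = ev r b * (b - iota c) + iota phi.[c].
      have -> : phi = r * ('X - c%:P) + (phi.[c])%:P by rewrite -hr subrK.
      rewrite {1}rmorphD rmorphM /= map_polyXsubC map_polyC !hornerE /=.
      by rewrite subrr mulr0 add0r.
    have : vge v (iota phi.[c]) 1.
      have -> : iota phi.[c] = ev phi b - ev r b * (b - iota c) by rewrite pE; ring.
      by rewrite (vgeB pv) // -[1]add0r (vgeM pv) // (vge_horner pv).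
    rewrite /vge fmorph_eq0; have [//|nz] := eqVneq phi.[c] 0.
    by rewrite (place_const pv).
  have bc0 : vge v (b - iota c) 0 by rewrite (vgeB pv) // (vge_const pv).
  have nz : b - iota c != 0 by apply: contraNneq n1 => ->; rewrite vge0.
  by split=> //; move: n1 bc0; rewrite /vge (negbTE nz) /=; lia.
have -> : b ^+ q - b = \prod_(c : K) (b - iota c).
  have := congr1 (fun p => ev p b) (finField_genPoly K).
  rewrite /= rmorphB /= map_polyXn map_polyX !hornerE rmorph_prod horner_prod => ->.
  by apply: eq_bigr => c _; rewrite /= map_polyXsubC !hornerE.
split; first by apply/prodf_neq0 => c _; case: (hc c).
apply: (@proj2 (\prod_c (b - iota c) != 0)).
apply: (big_ind (fun x => x != 0 /\ v x = 0)) => [|x y [x0 vx] [y0 vy]|c _].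
- by rewrite oner_neq0 (place1 pv).
- by rewrite mulf_neq0 // (placeM pv) // vx vy.
- exact: hc.
Qed.

(* [phi (b ^ q) = phi b ^ q], so Frobenius powers of a residual root are roots to any precision. *)
Lemma approximate_root v l (phi : {poly K}) (M : nat) : is_place iota v -> (l %| pdeg v)%N ->
  irreducible_poly phi -> (2 < size phi)%N -> phi %| 'X^(q ^ l) - 'X ->
  exists b, [/\ vge v b 0, vge v (ev phi b) M, vge v (ev phi (b ^+ q)) M,
    b ^+ q - b != 0 & v (b ^+ q - b) = 0].
Proof.
move=> pv /dvdnP[k dk] irr sphi pX.
have /(place_degP pv)[u hu] := pdegP place_degE pv.
have [||z z0 pz] := residue_root pv hu (p := phi); first by apply: ltnW.
  apply: dvdp_trans pX _; rewrite dk mulnC expnM; exact: dvdp_XnX.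
have q1 : (1 < q)%N := finNzRing_gt1 K.
have bz n : vge v (z ^+ n) 0 by rewrite -(mul0rn _ n) (vgeX pv).
have pM m n : (m <= n)%N -> vge v (ev phi (z ^+ (q ^ n))) m.
  move=> mn; rewrite ev_expq; apply: vge_le (vgeX pv (q ^ n) pz).
  by rewrite natz lez_nat (leq_trans mn) // ltnW // ltn_expl.
(* The exponent [M.+1] keeps the value of [phi] at the power positive even for [M = 0]. *)
have [|nb vb] := val_Frobenius_sub pv irr sphi (bz (q ^ M.+1)%N).
  exact: (pM 1%N).
exists (z ^+ (q ^ M.+1)); split=> //; first exact: pM.
by rewrite -exprM -expnSr; apply: pM; lia.
Qed.

(** These are the divisors [div f + n w] for [f] in L(n w). Fixing the first coordinate of [f] to 1
    picks one function in each line, and the divisor determines [f] up to a constant by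
    [LD0_const]. *)
Lemma many_divisors (w : place) n : is_place iota w -> (gg <= n * pdeg w)%N ->
  exists Z : 'rV[K]_(n * pdeg w - gg) -> div, injective Z /\
    forall x, (forall v, 0 <= Z x v) /\ hasdeg (Z x) (n * pdeg w)%N%:Z.
Proof.
move=> pw gn; set a := (n * pdeg w)%N; set k := (a - gg)%N.
pose D : div := fun v => n%:Z * point w v.
have hD : hasdeg D a by have := hasdegZ n (hasdeg_point pw); rewrite -PoszM.
have [m [u [uD iu um]]] := riemann place_degE hgg hD.
have km : (k.+1 <= m)%N by lia.
pose b i := u (widen_ord km i).
have bD i : LD D (b i) by apply: uD.
have ib : indep iota b by apply: indep_sub iu => i j [] /val_inj.
pose G (x : 'rV[K]_k) := comb iota b (row_mx (1 : 'rV[K]_1) x : 'rV_(1 + k)).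
have GD x : LD D (G x) by apply: subspace_comb (LD_subspace iota D) bD.
have G0 x : G x != 0.
  apply/eqP => /ib; rewrite -[RHS](@row_mx0 _ 1 1 k) => h.
  have [/rowP/(_ 0)] := @eq_row_mx _ 1 1 k _ _ _ _ h.
  by rewrite !mxE => /eqP; rewrite oner_eq0.
have GI x y c : G x = iota c * G y -> x = y.
  move=> /eqP; rewrite -subr_eq0 => /eqP h.
  have /ib : comb iota b (- c *: (row_mx 1 y : 'rV_(1 + k)) + row_mx 1 x) = 0.
    by rewrite combP rmorphN mulNr addrC.
  rewrite scale_row_mx add_row_mx -[RHS](@row_mx0 _ 1 1 k) => h'.
  have [/rowP/(_ 0)] := @eq_row_mx _ 1 1 k _ _ _ _ h'.
  rewrite !mxE /= mulr1 => /eqP; rewrite addrC subr_eq0 => /eqP <-.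
  by rewrite scaleN1r => /eqP; rewrite addrC subr_eq0 => /eqP.
exists (fun x => zeros iota (G x) D); split=> [x y xy|x]; last first.
  split=> [v|]; first exact: zeros_ge0.
  exact: (hasdeg_zeros place_degE hgg).
have [c hc] : exists c, G x / G y = iota c.
  apply: (LD0_const place_degE hgg alg_closed) => v pv.
  rewrite oppr0 /vge (placeM pv) ?invr_eq0 // (placeV pv).
  have := congr1 (fun f => f v) xy; rewrite /= !zerosE // => /addIr ->.
  by rewrite subrr lexx orbT.
by apply: (GI _ _ c); rewrite -hc divfK.
Qed.

(** For [n = c + gg], Riemann's inequality gives a nonzero function in L(n w - v), so [v] occurs in
    [div f + n w] for some nonzero [f] of L(n w). That space is finite, and each of these divisors
    has finite support. *)
Lemma finitely_many_places (w : place) (c : nat) : is_place iota w ->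
  exists s : seq place, forall v, is_place iota v -> (pdeg v <= c)%N -> v \in s.
Proof.
move=> pw; pose n := (c + gg)%N.
pose D : div := fun v => n%:Z * point w v.
have hD : hasdeg D (n%:Z * (pdeg w)%:Z) by apply: hasdegZ; apply: hasdeg_point.
have [N bN] := LD_bounded place_degE hgg hD.
have [m [u [_ uD iu su]]] := bounded_basis bN.
have S (x : 'rV[K]_m) : exists s : seq place, comb iota u x != 0 ->
    forall v, zeros iota (comb iota u x) D v != 0 -> v \in s.
  have [x0|x0] := eqVneq (comb iota u x) 0; first by exists [::].
  have Dx : LD D (comb iota u x) by apply: subspace_comb (LD_subspace iota D) uD.
  have [s [[_ _ hs] _]] := hasdeg_zeros place_degE hgg x0 Dx hD.
  by exists s => _.
have [s hs] := choice S.
exists (flatten [seq s x | x <- enum 'rV[K]_m]) => v pv vc.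
have [k [f [fD ifr fk]]] := riemann place_degE hgg (hasdegB hD (hasdeg_point pv)).
have k0 : (0 < k)%N by have := pdeg_gt0 place_degE pw; rewrite /n in fk *; nia.
have f0 : f (Ordinal k0) != 0.
  apply/eqP => f0; have := ifr (delta_mx 0 (Ordinal k0)).
  rewrite /comb (bigD1 (Ordinal k0)) //= f0 mulr0 add0r big1 => [/(_ erefl)|i ni].
    by move=> /rowP/(_ (Ordinal k0)); rewrite !mxE !eqxx => /eqP; rewrite oner_eq0.
  by rewrite mxE eqxx (negbTE ni) rmorph0 mul0r.
have fv := fD (Ordinal k0) v pv.
have fDD : LD D (f (Ordinal k0)).
  by apply: LD_le (fD _) => z; rewrite gerBl ler0n.
have [x fx] := su _ fDD.
apply/flattenP; exists (s x); first by apply: map_f; rewrite mem_enum.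
apply: (hs x); rewrite -?fx //; rewrite zerosE //.
by move: fv; rewrite /vge (negbTE f0) /= /point eqxx; lia.
Qed.
End DivisorCounting.

(** * The degrees of the places have no common divisor *)

Section Schmidt.
Variables (K : finFieldType) (F : fieldType) (iota : {rmorphism K -> F}).
Local Notation place := (F -> int).
Local Notation div := (place -> int).
Local Notation q := #|K|.
Local Notation ev p x := ((map_poly iota p).[x]).
Local Notation hasdeg := (hasdeg iota).
Local Notation LD := (LD iota).
Local Notation pdeg := (pdeg iota).
Hypothesis place_degE : forall v, is_place iota v -> exists d, place_deg iota v d.
Variable gg : nat.
Hypothesis hgg : genus iota gg.
Hypothesis alg_closed : forall z, algebraic iota z -> exists c, z = iota c.

Lemma coeff_le_deg E d v : (forall v, 0 <= E v) -> hasdeg E d -> E v * (pdeg v)%:Z <= d.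
Proof.
move=> E0 [s [[us ps sE] ->]].
have [->|Ev] := eqVneq (E v) 0.
  by rewrite mul0r; apply: sumr_ge0 => u _; rewrite mulr_ge0.
rewrite (bigD1_seq v) ?sE //= lerDl; apply: sumr_ge0 => u _.
by rewrite mulr_ge0.
Qed.

Lemma hasdeg_place E d v : hasdeg E d -> E v != 0 -> is_place iota v.
Proof. by move=> [s [[_ ps sE] _]] /sE /ps. Qed.

Lemma coeff_le E d v : (forall v, 0 <= E v) -> hasdeg E d -> 0 <= E v <= d.
Proof.
move=> E0 hE; rewrite E0 /=; apply: le_trans (coeff_le_deg v E0 hE).
have [->|Ev] := eqVneq (E v) 0; first by rewrite mul0r.
by have := pdeg_gt0 place_degE (hasdeg_place hE Ev); have := E0 v; nia.
Qed.

(** The divisor [max(E, E') - E] is positive of degree at most [c], which bounds its coefficients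
    and the degrees of the places in its support. *)
Lemma excess_bound (E E' : div) e m (c : nat) : hasdeg E e ->
  hasdeg (fun v => Num.max (E v) (E' v)) m -> m - e <= c ->
  forall v, E' v - E v <= c /\ (E v < E' v -> is_place iota v /\ (pdeg v <= c)%N).
Proof.
move=> hE hm mc v; have hD := hasdegB hm hE.
have D0 u : 0 <= Num.max (E u) (E' u) - E u by rewrite subr_ge0 le_max lexx.
have /andP[_] := coeff_le v D0 hD; have := coeff_le_deg v D0 hD.
have := @hasdeg_place _ _ v hD; have := D0 v.
case: leP => [le_EE'|lt_E'E] h1 h2 h3 h4; split; try lia.
by move=> lt_EE'; split; [apply: h2; lia | nia].
Qed.

(** * Elements of the constant field extension that vanish along a pair of divisors *)

Section Fibre.
Variables (phi : {poly K}) (e' : nat).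
Local Notation e := (2 + e')%N.
Hypothesis sphi : size phi = e.+1.
Hypothesis irr : irreducible_poly (map_poly iota phi).
Variables (beta : place -> F) (M : nat).
Hypothesis hbeta : forall v, is_place iota v ->
  [/\ vge v (beta v) 0, vge v (ev phi (beta v)) M, vge v (ev phi (beta v ^+ q)) M,
    beta v ^+ q - beta v != 0 & v (beta v ^+ q - beta v) = 0].
Variables (D : div) (l : nat) (u : 'I_l -> F).
Hypotheses (uD : forall i, LD D (u i)) (iu : indep iota u).

(** A matrix over [K] encodes the element of [F['X] / phi] whose [k]-th coefficient is [coefs X k],
    a function in L(D). *)
Definition coefs (X : 'M[K]_(e, l)) (k : 'I_e) : F := comb iota u (row k X).

(** The evaluations at the approximate root [beta v] of [phi] and at its Frobenius conjugate stand
    for two places above [v] in the constant field extension; [E1] is prescribed at the first and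
    [E2] at the second. *)
Definition vanishes (X : 'M[K]_(e, l)) (E1 E2 : div) : Prop :=
  forall v, is_place iota v ->
    vge v (\sum_(k < e) coefs X k * beta v ^+ k) (E1 v - D v) /\
    vge v (\sum_(k < e) coefs X k * (beta v ^+ q) ^+ k) (E2 v - D v).

Lemma coefs_LD X k : LD D (coefs X k).
Proof. exact: (subspace_comb _ (LD_subspace iota D)) uD. Qed.

Lemma vanishing_matrix E (n : nat) (x : place -> F) :
  (forall v, is_place iota v -> vge v (x v) 0) ->
  (forall v, 0 <= E v) -> hasdeg E n ->
  exists T : 'M[K]_(#|{: 'I_e * 'I_l}|, n), forall X : 'M[K]_(e, l),
    \row_j X (enum_val j).1 (enum_val j).2 *m T = 0 ->
    forall v, is_place iota v ->
      vge v (\sum_(k < e) coefs X k * x v ^+ k) (E v - D v).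
Proof.
move=> x0 E0 [s [[us ps sE] ns]].
pose w v (t : 'I_e * 'I_l) := x v ^+ t.1 * u t.2.
have Xx v k : is_place iota v -> vge v (x v ^+ k) 0.
  by move=> pv; rewrite -(mul0rn _ k) (vgeX pv) // x0.
have [|||n' [T [nT hT]]] := @local_conditions _ _ _ place_degE _ s
  (fun v (j : 'I_#|{: 'I_e * 'I_l}|) => w v (enum_val j)) (fun v => - D v) E.
- exact: ps.
- by move=> v i /ps pv; rewrite /w -[- D v]add0r (vgeM pv) ?Xx // uD.
- by move=> v _.
move: nT; rewrite -ns => -[nn']; rewrite {n'}nn' in T hT.
exists T => X XT v pv.
have -> : \sum_(k < e) coefs X k * x v ^+ k =
    comb iota (fun j : 'I_#|{: 'I_e * 'I_l}| => w v (enum_val j))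
      (\row_j X (enum_val j).1 (enum_val j).2).
  rewrite (comb_enum iota (w v) (fun t : 'I_e * 'I_l => X t.1 t.2)).
  rewrite -(pair_bigA _ (fun (k : 'I_e) (i : 'I_l) => iota (X k i) * w v (k, i))) /=.
  apply: eq_bigr => k _; rewrite /coefs /comb mulr_suml; apply: eq_bigr => i _.
  by rewrite mxE /w /=; ring.
have [vs|vs] := boolP (v \in s); first by rewrite addrC; apply: hT.
have /eqP -> : E v == 0 by apply: contraNT vs; apply: sE.
rewrite add0r; apply: (subspace_comb _ (vge_subspace pv _)) => j.
by rewrite /w -[- D v]add0r (vgeM pv) ?Xx // uD.
Qed.

(** There are [e * l] unknown coefficients in [K] and [n1 + n2] linear conditions. *)
Lemma exists_vanishing E1 E2 (n1 n2 : nat) :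
  (forall v, 0 <= E1 v) -> (forall v, 0 <= E2 v) ->
  hasdeg E1 n1 -> hasdeg E2 n2 -> (n1 + n2 < e * l)%N ->
  exists X, X != 0 /\ vanishes X E1 E2.
Proof.
move=> E10 E20 h1 h2 nl.
have [|T1 hT1] := @vanishing_matrix E1 n1 beta _ E10 h1.
  by move=> v /hbeta[].
have [|T2 hT2] := @vanishing_matrix E2 n2 (fun v => beta v ^+ q) _ E20 h2.
  by move=> v pv; case: (hbeta pv) => b0 _ _ _ _; rewrite -(mul0rn _ q) (vgeX pv).
pose T := row_mx T1 T2.
have : kermx T != 0.
  rewrite -mxrank_eq0 mxrank_ker subn_eq0 -ltnNge.
  by apply: leq_ltn_trans (rank_leq_col _) _; rewrite card_prod !card_ord.
move=> /rowV0Pn[c /sub_kermxP cT c0].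
pose X : 'M[K]_(e, l) := \matrix_(k, i) c 0 (enum_rank (k, i)).
have cX : c = \row_j X (enum_val j).1 (enum_val j).2.
  by apply/rowP => j; rewrite !mxE -surjective_pairing enum_valK.
exists X; split.
  apply: contraNneq c0 => X0; rewrite cX X0.
  by apply/eqP/rowP => j; rewrite !mxE.
move: cT; rewrite mul_mx_row -(row_mx0 _ 1) => /eq_row_mx[cT1 cT2] v pv.
by split; [apply: hT1|apply: hT2]; rewrite -?cX.
Qed.

Lemma vanishes_max X E1 E2 E1' E2' : vanishes X E1 E2 -> vanishes X E1' E2' ->
  vanishes X (fun v => Num.max (E1 v) (E1' v)) (fun v => Num.max (E2 v) (E2' v)).
Proof.
move=> h h' v pv; have [h1 h2] := h v pv; have [h1' h2'] := h' v pv.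
by split; case: leP.
Qed.

(** The norm of the element is nonzero, since [phi] stays irreducible over [F], and lies in L(e D -
    E1 - E2) by [vge_det_mulphi]. The bound [M] keeps the prescribed orders within the precision of
    the roots. *)
Lemma vanishes_deg X E1 E2 (d e1 e2 : int) : X != 0 -> vanishes X E1 E2 ->
  (forall v, 0 <= E1 v <= M%:Z) -> (forall v, 0 <= E2 v <= M%:Z) ->
  hasdeg D d -> hasdeg E1 e1 -> hasdeg E2 e2 -> e1 + e2 <= e%:Z * d.
Proof.
move=> X0 hX E1M E2M hD h1 h2.
have N0 : \det (mulphi_mx iota phi (coefs X)) != 0.
  apply: det_mulphi_neq0 => //; apply: contrapT => nk.
  move/negP: X0; apply; apply/eqP/row_matrixP => k; rewrite row0; apply: iu.
  by apply: contrapT => /eqP Xk; apply: nk; exists k.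
have := LD_deg_ge0 place_degE hgg N0 _ (hasdegB (hasdegZ e%:Z hD) (hasdegD h1 h2)).
rewrite subr_ge0; apply => v pv.
have [b0 p1 p2 nb vb] := hbeta pv; have [v1 v2] := hX v pv.
have -> : - (e%:Z * D v - (E1 v + E2 v)) = E1 v + E2 v - D v *+ e.
  by rewrite opprB -mulr_natl natz.
have bq0 : vge v (beta v ^+ q) 0 by rewrite -(mul0rn _ q) (vgeX pv).
exact: (vge_det_mulphi sphi pv (fun k => coefs_LD X k pv) b0 bq0 p1 p2 nb vb
  (E1M v) (E2M v) v1 v2).
Qed.

(** The element also vanishes along the two maxima, whose total degree is thus at most [e * d]. Each
    maximum then exceeds [E1] or [E2] by degree at most [c]. *)
Lemma vanishes_close X E1 E2 E1' E2' (c : nat) (d e1 e2 e1' e2' : int) : X != 0 ->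
  vanishes X E1 E2 -> vanishes X E1' E2' ->
  (forall v, 0 <= E1 v <= M%:Z) -> (forall v, 0 <= E2 v <= M%:Z) ->
  (forall v, 0 <= E1' v <= M%:Z) -> (forall v, 0 <= E2' v <= M%:Z) ->
  hasdeg D d -> hasdeg E1 e1 -> hasdeg E2 e2 -> hasdeg E1' e1' -> hasdeg E2' e2' ->
  e%:Z * d <= e1 + e2 + c -> forall v,
  (E1' v - E1 v <= c /\ (E1 v < E1' v -> is_place iota v /\ (pdeg v <= c)%N)) /\
  (E2' v - E2 v <= c /\ (E2 v < E2' v -> is_place iota v /\ (pdeg v <= c)%N)).
Proof.
move=> X0 v1 v2 b1 b2 b1' b2' hD h1 h2 h1' h2' edc v.
have [m1 hm1] := hasdeg_max h1 h1'; have [m2 hm2] := hasdeg_max h2 h2'.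
have bmax G G' : (forall v, 0 <= G v <= M%:Z) -> (forall v, 0 <= G' v <= M%:Z) ->
    forall v : place, 0 <= Num.max (G v) (G' v) <= M%:Z.
  by move=> bG bG' z; rewrite maxEle; case: ifP => _; [apply: bG' | apply: bG].
have := vanishes_deg X0 (vanishes_max v1 v2) (bmax _ _ b1 b1') (bmax _ _ b2 b2') hD hm1 hm2.
have m1e : e1 <= m1 by apply: hasdeg_le h1 hm1 => z; rewrite le_max lexx.
have m2e : e2 <= m2 by apply: hasdeg_le h2 hm2 => z; rewrite le_max lexx.
move=> mm; split.
  by apply: (excess_bound h1 hm1); lia.
by apply: (excess_bound h2 hm2); lia.
Qed.

End Fibre.

(** The pairs in [T] number [k * q ^ (n * d1 - 2 * gg)], with [k] growing linearly in [n]. They are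
    mapped to [q ^ (n * d1 + C)] matrices with fibres of size at most [B]. As [B] and [C] do not
    depend on [n], a large [n] is contradictory. *)
Lemma index_one l w : (1 < l)%N -> is_place iota w ->
  ~ forall v, is_place iota v -> (l %| pdeg v)%N.
Proof.
move=> l1 pw ldiv.
(* The final contradiction [k > q ^ (C + 2 * gg) * B], with [a = e'], [b = gg] and [G] the
   right-hand side. *)
have arith a b G : (G < (2 + a) * (2 * b + G + 1) - 2 * b)%N by nia.
have [phi [irr sphi phiX]] := exists_nonlinear_irreducible K l1.
have irrF := irreducible_const_ext alg_closed (ltnW l1) irr phiX.
pose e' := (size phi - 3)%N; pose e := (2 + e')%N.
have sphiE : size phi = e.+1 by rewrite /e /e'; lia.
pose d1 := pdeg w; have d10 : (0 < d1)%N := pdeg_gt0 place_degE pw.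
(* The difference between [e] times the degree of [D] and the total degree [n * d1] of a pair. *)
pose c := (e * gg * d1)%N.
have [s hs] := finitely_many_places place_degE hgg c pw.
pose Fs := {ffun 'I_(size s) -> 'I_(2 * c).+1}.
(* The surplus of unknowns over conditions: [e * l0 = n * d1 + C]. The summand [gg] in [N] makes it
   positive. *)
pose C := (e * (gg * d1 + 1 - gg))%N.
pose B := #|{: Fs * Fs}|.
pose n' := (2 * gg + q ^ (C + 2 * gg) * B + 1)%N.
pose n := (e * n')%N; pose N := (n' + gg)%N; pose M := (n * d1)%N.
pose D : div := fun v => N%:Z * point w v.
have hD : hasdeg D (N * d1)%N by rewrite PoszM; apply: hasdegZ; apply: hasdeg_point.
have [beta hbeta] : exists beta : place -> F, forall v, is_place iota v ->
  [/\ vge v (beta v) 0, vge v (ev phi (beta v)) M, vge v (ev phi (beta v ^+ q)) M,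
    beta v ^+ q - beta v != 0 & v (beta v ^+ q - beta v) = 0].
  suff /choice[beta hbeta] : forall v, exists b, is_place iota v ->
      [/\ vge v b 0, vge v (ev phi b) M, vge v (ev phi (b ^+ q)) M,
      b ^+ q - b != 0 & v (b ^+ q - b) = 0] by exists beta.
  move=> v; have [pv|pv] := pselect (is_place iota v); last by exists 0.
  have [b hb] := approximate_root place_degE M pv (ldiv v pv) irr sphi phiX.
  by exists b.
(* Only as many functions as Riemann's inequality guarantees are kept, so that the number of
   matrices is known exactly. *)
pose l0 := (N * d1 + 1 - gg)%N.
have [m [u0 [uD0 iu0 um]]] := riemann place_degE hgg hD.
have lm : (l0 <= m)%N by rewrite /l0; lia.
pose u i := u0 (widen_ord lm i).
have uD i : LD D (u i) by apply: uD0.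
have iu : indep iota u by apply: indep_sub iu0 => i j [] /val_inj.
pose k := (n - 2 * gg)%N.
(* Both parts of the splitting of [n] are at least [gg], as [many_divisors] requires. *)
pose n1 (i : 'I_k) := (gg + i)%N; pose n2 (i : 'I_k) := (n - (gg + i))%N.
have gn1 i : (gg <= n1 i * d1)%N.
  by apply: leq_trans (leq_addr i gg) _; apply: leq_pmulr.
have gn2 i : (gg <= n2 i * d1)%N.
  apply: (@leq_trans (n2 i)); last exact: leq_pmulr.
  by have := ltn_ord i; rewrite /n2 /k; move: (nat_of_ord i) => j; move: (n) => n0; lia.
have n12 i : (n1 i * d1 + n2 i * d1 = n * d1)%N.
  rewrite -mulnDl; congr (_ * _)%N; have := ltn_ord i.
  by rewrite /n1 /n2 /k; move: (nat_of_ord i) => j; move: (n) => n0; lia.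
pose Z1 i := projT1 (cid (many_divisors place_degE hgg alg_closed pw (gn1 i))).
pose Z2 i := projT1 (cid (many_divisors place_degE hgg alg_closed pw (gn2 i))).
have hZ1 i : injective (Z1 i) /\
  forall x, (forall v, 0 <= Z1 i x v) /\ hasdeg (Z1 i x) (n1 i * d1)%N%:Z.
  by rewrite /Z1; case: cid.
have hZ2 i : injective (Z2 i) /\
  forall x, (forall v, 0 <= Z2 i x v) /\ hasdeg (Z2 i x) (n2 i * d1)%N%:Z.
  by rewrite /Z2; case: cid.
pose T : finType := {i : 'I_k & ('rV[K]_(n1 i * d1 - gg) * 'rV[K]_(n2 i * d1 - gg))%type}.
pose E1 (t : T) := Z1 (tag t) (tagged t).1.
pose E2 (t : T) := Z2 (tag t) (tagged t).2.
have E10 t v : 0 <= E1 t v by case: (hZ1 (tag t)) => _ /(_ (tagged t).1)[+ _]; apply.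
have E20 t v : 0 <= E2 t v by case: (hZ2 (tag t)) => _ /(_ (tagged t).2)[+ _]; apply.
have hE1 t : hasdeg (E1 t) (n1 (tag t) * d1)%N%:Z by case: (hZ1 (tag t)) => _ /(_ (tagged t).1)[].
have hE2 t : hasdeg (E2 t) (n2 (tag t) * d1)%N%:Z by case: (hZ2 (tag t)) => _ /(_ (tagged t).2)[].
have EI t t' : E1 t = E1 t' -> E2 t = E2 t' -> t = t'.
  move=> e1 e2; have tt' : tag t = tag t'.
    have := hE1 t; rewrite e1 => /hasdeg_uniq /(_ (hE1 t')) [] /eqP.
    by rewrite eqn_pmul2r // eqn_add2l => /eqP /val_inj.
  case: t t' tt' e1 e2 => i [x y] [i' [x' y']] /= ii'; move: ii' x' y' => <- x' y'.
  by move=> /(hZ1 i).1 /= -> /(hZ2 i).1 /= ->.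
have EM1 t v : 0 <= E1 t v <= M%:Z.
  have /andP[-> /= h] := coeff_le v (E10 t) (hE1 t); apply: le_trans h _.
  by rewrite lez_nat /M -(n12 (tag t)) leq_addr.
have EM2 t v : 0 <= E2 t v <= M%:Z.
  have /andP[-> /= h] := coeff_le v (E20 t) (hE2 t); apply: le_trans h _.
  by rewrite lez_nat /M -(n12 (tag t)) leq_addl.
have el0 : (e * l0 = n * d1 + C)%N.
  have ggd : (gg <= gg * d1)%N by apply: leq_pmulr.
  rewrite /l0 /N /C /n -mulnA -mulnDr mulnDl; congr (_ * _)%N.
  by move: (n' * d1)%N (gg * d1)%N ggd => x y; lia.
have /choice[X hX] : forall t, exists X, X != 0 /\ vanishes (e' := e') beta D u X (E1 t) (E2 t).
  move=> t; apply: (exists_vanishing hbeta uD (E10 t) (E20 t) (hE1 t) (hE2 t)).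
  rewrite n12 -/e el0 -{1}[(n * d1)%N]addn0 ltn_add2l /C muln_gt0 /=.
  by have : (gg <= gg * d1)%N := leq_pmulr _ d10; move: (gg * d1)%N => y; lia.
have deg_eq (t : T) : e%:Z * (N * d1)%N <= (n1 (tag t) * d1)%N%:Z + (n2 (tag t) * d1)%N + c.
  rewrite -!PoszD n12 -PoszM lez_nat /N /n /c mulnDl mulnDr !mulnA.
  by rewrite leqnn.
have close t t' : X t = X t' -> forall v,
  (E1 t' v - E1 t v <= c /\ (E1 t v < E1 t' v -> is_place iota v /\ (pdeg v <= c)%N)) /\
  (E2 t' v - E2 t v <= c /\ (E2 t v < E2 t' v -> is_place iota v /\ (pdeg v <= c)%N)).
  move=> XX; have [X0 vX] := hX t; have [_ vX'] := hX t'; rewrite -XX in vX'.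
  exact: (vanishes_close sphiE irrF hbeta uD iu X0 vX vX' (EM1 t) (EM2 t)
    (EM1 t') (EM2 t') hD (hE1 t) (hE2 t) (hE1 t') (hE2 t') (deg_eq t)).
(* Pairs with the same matrix differ from a fixed pair [t0] by at most [c], and only at the places
   of [s]. The differences, shifted by [c] into the range from 0 to [2 * c], determine the pair. *)
have fibre (Y : 'M[K]_(e, l0)) : (#|[set t | X t == Y]| <= B)%N.
  have [->|[t0]] := set_0Vmem [set t | X t == Y]; first by rewrite cards0.
  rewrite inE => /eqP Xt0.
  pose code (E : T -> div) t : Fs := [ffun i : 'I_(size s) =>
    inord `|(E t (tnth (in_tuple s) i) - E t0 (tnth (in_tuple s) i) + c%:Z)%R|%N].
  have code_inj (E : T -> div) t t' :
      (forall v, E t v - E t0 v <= c /\ (E t0 v < E t v -> is_place iota v /\ (pdeg v <= c)%N)) ->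
      (forall v, E t0 v - E t v <= c /\ (E t v < E t0 v -> is_place iota v /\ (pdeg v <= c)%N)) ->
      (forall v, E t' v - E t0 v <= c /\ (E t0 v < E t' v -> is_place iota v /\ (pdeg v <= c)%N)) ->
      (forall v, E t0 v - E t' v <= c /\ (E t' v < E t0 v -> is_place iota v /\ (pdeg v <= c)%N)) ->
      code E t = code E t' -> E t = E t'.
    move=> h1 h2 h3 h4 /ffunP cc; apply: funext => v.
    have [h1a h1b] := h1 v; have [h2a h2b] := h2 v.
    have [h3a h3b] := h3 v; have [h4a h4b] := h4 v.
    have [vs|vs] := boolP (v \in s).
      have := cc (Ordinal (etrans (index_mem v s) vs)).
      rewrite !ffunE (tnth_nth (fun _ => 0)) /= nth_index //.
      move=> /(congr1 val); rewrite /= !inordK;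
        move: (E t v) (E t' v) (E t0 v) h1a h2a h3a h4a; lia.
    have nv : ~ (is_place iota v /\ (pdeg v <= c)%N).
      by move=> [pv vc]; move/negP: vs; apply; apply: hs.
    have := contra_not h1b nv; have := contra_not h2b nv.
    have := contra_not h3b nv; have := contra_not h4b nv.
    move: (E t v) (E t' v) (E t0 v); lia.
  apply: (@leq_trans #|[set (code E1 t, code E2 t) | t in [set t | X t == Y]]|);
    last exact: max_card.
  rewrite card_in_imset // => t t'; rewrite !inE => /eqP Xt /eqP Xt' [].
  have c1 := close t0 t (etrans Xt0 (esym Xt)); have c2 := close t t0 (etrans Xt (esym Xt0)).
  have c3 := close t0 t' (etrans Xt0 (esym Xt')); have c4 := close t' t0 (etrans Xt' (esym Xt0)).
  move=> k1 k2; apply: EI.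
    by apply: code_inj k1 => v; [case: (c1 v)|case: (c2 v)|case: (c3 v)|case: (c4 v)].
  by apply: code_inj k2 => v; [case: (c1 v)|case: (c2 v)|case: (c3 v)|case: (c4 v)].
have cardT1 : (#|T| <= q ^ (n * d1 + C) * B)%N.
  rewrite -el0 -card_mx -sum_nat_const -sum1_card (partition_big X xpredT) //=.
  apply: leq_sum => Y _; apply: leq_trans (fibre Y).
  by rewrite -sum1_card; apply/eq_leq/eq_bigl => t; rewrite inE.
have cardT2 : (#|T| * q ^ (2 * gg) = k * q ^ (n * d1))%N.
  rewrite card_tagged sumnE big_map big_enum /= big_distrl /=.
  rewrite (eq_bigr (fun => (q ^ (n * d1))%N)) ?sum_nat_const ?card_ord // => i _.
  rewrite card_prod !card_mx !mul1n -!expnD; congr (_ ^ _)%N.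
  by have := n12 i; have := gn1 i; have := gn2 i; lia.
have q0 : (0 < q)%N by apply: ltnW; apply: finNzRing_gt1.
have : (k * q ^ (n * d1) <= q ^ (C + 2 * gg) * B * q ^ (n * d1))%N.
  rewrite -cardT2; apply: leq_trans (leq_mul cardT1 (leqnn _)) _.
  by rewrite mulnAC -expnD [X in (_ <= X)%N]mulnAC -expnD -addnA addnC.
rewrite leq_pmul2r ?expn_gt0 ?q0 // leqNgt => /negP; apply.
exact: arith.
Qed.
End Schmidt.

(** * Independent blocks from Riemann-Roch spaces *)

Section Blocks.
Variables (g r : nat).
Hypothesis r0 : (0 < r)%N.

Lemma block_subproof (j : 'I_(g * r)) : (j %/ r < g)%N.
Proof. by rewrite ltn_divLR. Qed.
Definition block j : 'I_g := Ordinal (block_subproof j).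

Lemma offset_subproof (j : 'I_(g * r)) : (j %% r < r)%N.
Proof. by rewrite ltn_pmod. Qed.
Definition offset j : 'I_r := Ordinal (offset_subproof j).

Lemma position_subproof (k : 'I_g) (y : 'I_r) : (k * r + y < g * r)%N.
Proof. by clear r0; have := ltn_ord k; have := ltn_ord y; nia. Qed.
Definition position k y : 'I_(g * r) := Ordinal (position_subproof k y).

Lemma positionK j : position (block j) (offset j) = j.
Proof. by apply: val_inj; rewrite /= -divn_eq. Qed.

Lemma block_position k y : block (position k y) = k.
Proof. by apply: val_inj; rewrite /= divnMDl // divn_small ?addn0. Qed.

Lemma offset_position k y : offset (position k y) = y.
Proof. by apply: val_inj; rewrite /= modnMDl modn_small. Qed.

Definition block_support (R : nzRingType) (x : 'rV[R]_(g * r)) : {set 'I_g} :=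
  [set block j | j in [set j | x 0 j != 0]].

(** The rows of [G] lying in any [h] blocks, taken together, are linearly independent. *)
Definition block_independent (R : nzRingType) h m (G : 'M[R]_(g * r, m)) : Prop :=
  forall x : 'rV[R]_(g * r), x *m G = 0 -> (#|block_support x| <= h)%N -> x = 0.

End Blocks.

Section AGCode.
Variables (K : finFieldType) (F : fieldType) (iota : {rmorphism K -> F}).
Local Notation place := (F -> int).
Local Notation div := (place -> int).
Local Notation hasdeg := (hasdeg iota).
Local Notation LD := (LD iota).
Local Notation pdeg := (pdeg iota).
Hypothesis place_degE : forall v, is_place iota v -> exists d, place_deg iota v d.
Variable gg : nat.
Hypothesis hgg : genus iota gg.
Hypothesis alg_closed : forall z, algebraic iota z -> exists c, z = iota c.

(** By division with remainder the least positive degree divides the degree of every place, so it is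
    1 by [index_one]. *)
Lemma exists_hasdeg w d : is_place iota w -> exists D, hasdeg D d.
Proof.
move=> pw; pose P n := (0 < n)%N && `[< exists D, hasdeg D n%:Z >].
have [|n /andP[n0 /asboolP[D hD]] mn] := @ex_minnP P.
  exists (pdeg w); rewrite /P (pdeg_gt0 place_degE pw); apply/asboolP.
  by exists (point w); apply: hasdeg_point.
suff n1 : n = 1%N.
  by exists (fun v => d * D v); rewrite n1 in hD; have := hasdegZ d hD; rewrite mulr1.
apply/eqP; rewrite eqn_leq n0 andbT leqNgt; apply/negP => n1.
apply: (index_one place_degE hgg alg_closed n1 pw) => v pv.
have [//|nd] := boolP (n %| pdeg v)%N.
suff /mn : P (pdeg v %% n)%N by rewrite leqNgt ltn_pmod.
rewrite /P lt0n nd; apply/asboolP.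
exists (fun u => point v u - (pdeg v %/ n)%N%:Z * D u).
have := hasdegB (hasdeg_point pv) (hasdegZ (pdeg v %/ n)%N%:Z hD).
have -> // : (pdeg v)%:Z - (pdeg v %/ n)%N%:Z * n%:Z = (pdeg v %% n)%N.
by rewrite {1}(divn_eq (pdeg v) n) PoszD PoszM addrAC subrr add0r.
Qed.

Lemma hasdeg_sum (I : Type) (s : seq I) (P : pred I) (D : I -> div) (d : I -> int) :
  (forall i, hasdeg (D i) (d i)) ->
  hasdeg (fun v => \sum_(i <- s | P i) D i v) (\sum_(i <- s | P i) d i).
Proof.
move=> hD; elim: s => [|i s IH].
  by rewrite big_nil; apply: hasdeg_ext (hasdeg0 iota) => v; rewrite big_nil.
rewrite big_cons; case Pi: (P i).
  by apply: hasdeg_ext (hasdegD (hD i) IH) => v; rewrite big_cons Pi.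
by apply: hasdeg_ext IH => v; rewrite big_cons Pi.
Qed.

(** The rows of [B] are the residues of independent functions of L(D) modulo the divisors [Gd i],
    and [G] is a check matrix of their row space. *)
Lemma exists_block_independent (g r h : nat) (r0 : (0 < r)%N) (Gd : 'I_g -> div) :
  (h < g)%N -> (forall i v, 0 <= Gd i v) -> (forall i, hasdeg (Gd i) r) ->
  (forall i j, i != j -> forall v, Gd i v != 0 -> Gd j v = 0) ->
  exists G : 'M[K]_(g * r, 2 * gg + h * r), block_independent r0 h G.
Proof.
move=> hg G0 hG disj.
have [w pw] : exists w, is_place iota w.
  have [[|w s] [[us ps _] e]] := hG (Ordinal (leq_ltn_trans (leq0n h) hg)).
    by move: e r0; rewrite big_nil => -[->].
  by exists w; apply: ps; apply: mem_head.
(* The largest degree that becomes negative when any [g - h] divisors of degree [r] are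
   subtracted. *)
have [D hD] := exists_hasdeg ((r * (g - h))%N%:Z - 1) pw.
have [m [u [uD iu um]]] := riemann place_degE hgg hD.
have [T hT] := choice (fun i => LD_conditions place_degE uD (G0 i) (hG i)).
pose B : 'M[K]_(m, g * r) := \matrix_(a, j) T (block r0 j) a (offset r0 j).
have BT c k y : (c *m B) 0 (position k y) = (c *m T k) 0 y.
  rewrite !mxE; apply: eq_bigr => a _.
  by rewrite mxE block_position offset_position.
have key c : (#|block_support r0 (c *m B)| <= h)%N -> c = 0.
  set J := block_support r0 _ => Jh; apply: iu; apply: contrapT => /eqP f0.
  (* At each place at most one [Gd k] is nonzero, so vanishing modulo each of them is vanishing
     modulo their sum. *)
  have fD : LD (fun v => D v - \sum_(k | k \notin J) Gd k v) (comb iota u c).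
    move=> v pv.
    have kJ k : k \notin J -> vge v (comb iota u c) (- (D v - Gd k v)).
      move=> kJ; apply: (hT k) => //; apply/rowP => y; rewrite -BT [RHS]mxE.
      apply: contraNeq kJ => nz; apply/imsetP; exists (position k y).
        by rewrite inE.
      by rewrite block_position.
    have [[k /andP[kNJ kv]]|nk] := pselect (exists k, (k \notin J) && (Gd k v != 0)).
      rewrite (bigD1 k) //= big1 ?addr0; first exact: kJ.
      by move=> k' /andP[_ k'k]; apply: (disj k k') => //; rewrite eq_sym.
    rewrite big1 ?subr0; first exact: (subspace_comb _ (LD_subspace iota D) uD).
    move=> k kNJ; apply: contrapT => /eqP kv; apply: nk; exists k.
    by rewrite kNJ.
  have := LD_deg_ge0 place_degE hgg f0 fD (hasdegB hD (hasdeg_sum _ _ hG)).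
  rewrite sumr_const; set a := #|_|.
  have : (#|J| + a = g)%N by rewrite -[RHS]card_ord -(cardC J); congr (_ + _)%N.
  rewrite -mulr_natr natz; nia.
have fB : row_free B.
  rewrite -kermx_eq0; apply: contraT => /rowV0Pn[c /sub_kermxP cB c0].
  rewrite (key c) ?eqxx // in c0.
  rewrite cB /block_support (_ : [set j | _] = set0) ?imset0 ?cards0 //.
  by apply/setP => j; rewrite !inE mxE eqxx.
(* A vector [x] satisfies [x *m Q = 0] exactly when it lies in the row space of [B]. *)
pose Q := cokermx B.
have rQ : (\rank Q <= 2 * gg + h * r)%N.
  rewrite mxrank_coker (eqP fB); nia.
(* [col_base Q] has [\rank Q] columns; [pid_mx] pads them with zero columns to the required
   width. *)
exists (col_base Q *m pid_mx (\rank Q)) => x.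
rewrite mulmxA => xQ sx.
have fP : row_free (pid_mx (\rank Q) : 'M[K]_(\rank Q, 2 * gg + h * r)).
  by rewrite /row_free rank_pid_mx.
move/eqP: xQ; rewrite mulmx_free_eq0 // => /eqP xQ.
have : x *m Q = 0 by rewrite -(mulmx_base Q) mulmxA xQ mul0mx.
move/eqP; rewrite -submxE => /submxP[c xc].
by rewrite xc (key c) ?mul0mx // -xc.
Qed.
End AGCode.

(** * Reed-Solomon and Moore matrices *)

(** The MDS property: for [a <= r], fewer than [a] zeros means weight at least [r - a + 1]. *)
Definition row_weighted (R : fieldType) a r (A : 'M[R]_(a, r)) : Prop :=
  forall u : 'rV[R]_a, u != 0 -> (#|[set y | (u *m A) ord0 y == 0%R]| < a)%N.

Lemma subset_of_card (T : finType) (A : {set T}) n : (n <= #|A|)%N ->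
  exists2 B : {set T}, B \subset A & #|B| = n.
Proof.
move=> nA; exists [set x in take n (enum A)].
  by apply/subsetP => x; rewrite inE => /mem_take; rewrite mem_enum.
rewrite cardsE; have /card_uniqP -> : uniq (take n (enum A)) by rewrite take_uniq ?enum_uniq.
by rewrite size_takel // -cardE.
Qed.

(** The dual of an MDS code is MDS. Enlarge the support of [x] to a set [W] of [a] positions and
    take [y0] in the support. Some nonzero word vanishes on [W] minus [y0]; orthogonality to [x]
    makes it vanish at [y0] too, which is one zero too many. *)
Lemma row_weighted_dual (R : fieldType) a r (A : 'M[R]_(a, r)) (x : 'rV[R]_r) :
  (a <= r)%N -> row_weighted A -> x *m A^T = 0 ->
  (#|[set y | x ord0 y != 0%R]| <= a)%N -> x = 0.
Proof.
move=> ar wA xA sx; apply/rowP => y0; rewrite mxE; apply: contrapT => /eqP xy0.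
set Y := [set y | x 0 y != 0] in sx.
have [Z ZY cZ] : exists2 Z : {set 'I_r}, Z \subset ~: Y & #|Z| = (a - #|Y|)%N.
  by apply: subset_of_card; rewrite [X in (_ <= X)%N]cardsCs setCK card_ord leq_sub2r.
pose W := Y :|: Z.
have cW : #|W| = a.
  rewrite cardsU cZ (_ : Y :&: Z = set0) ?cards0 ?subn0 ?subnKC //.
  by apply/eqP; rewrite setI_eq0 disjoint_sym disjoints_subset.
have yW : y0 \in W by rewrite !inE xy0.
pose M : 'M[R]_(a, #|W :\ y0|) := \matrix_(i, t) A i (enum_val t).
have : kermx M != 0.
  rewrite -mxrank_eq0 mxrank_ker subn_eq0 -ltnNge.
  by apply: leq_ltn_trans (rank_leq_col _) _;
    rewrite -[X in (_ < X)%N]cW [X in (_ < X)%N](cardsD1 y0) yW.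
move=> /rowV0Pn[u /sub_kermxP uM u0].
have uA j : j \in W -> j != y0 -> (u *m A) 0 j = 0.
  move=> jW jy; have jWy : j \in W :\ y0 by rewrite in_setD1 jy.
  have /rowP/(_ (enum_rank_in jWy j)) := uM; rewrite !mxE => h.
  rewrite -[RHS]h; apply: eq_bigr => i _.
  by rewrite mxE enum_rankK_in.
have uAy : (u *m A) 0 y0 = 0.
  have : (u *m A *m x^T) 0 0 = 0.
    by rewrite -mulmxA -[A *m _]trmxK trmx_mul trmxK xA trmx0 mulmx0 mxE.
  rewrite mxE (bigD1 y0) //= big1 ?addr0 => [|j jy].
    by rewrite [x^T _ _]mxE => /eqP; rewrite mulf_eq0 (negbTE xy0) orbF => /eqP.
  have [jW|jW] := boolP (j \in W); first by rewrite uA ?mul0r.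
  by move: jW; rewrite !inE negb_or negbK [x^T _ _]mxE => /andP[/eqP -> _]; rewrite mulr0.
have := wA u u0; rewrite ltnNge -{1}cW; case/negP; apply: subset_leq_card.
apply/subsetP => j jW; rewrite inE; have [->|jy] := eqVneq j y0; first by rewrite uAy.
by rewrite uA.
Qed.

Section ReedSolomon.
Variables (K : finFieldType) (a r : nat).
Hypotheses (a0 : (0 < a)%N) (rq : (r <= #|K|.+1)%N).

Lemma card_points : (r <= #|{: option K}|)%N.
Proof. by rewrite card_option. Qed.

(* The point [None] of the projective line is the one at infinity. *)
Definition rs_point (y : 'I_r) : option K := enum_val (widen_ord card_points y).

Definition rs_mx : 'M[K]_(a, r) :=
  \matrix_(i, y) if rs_point y is Some c then c ^+ i else (i == a.-1 :> nat)%:R.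

Lemma rs_point_inj : injective rs_point.
Proof. by move=> y z /enum_val_inj [] /val_inj. Qed.

(** A word lists the values of a polynomial of degree less than [a], with its coefficient of degree
    [a - 1] at infinity. A zero at infinity lowers the number of possible roots by one. *)
Lemma rs_row_weighted (L : fieldType) (j : {rmorphism K -> L}) :
  row_weighted (map_mx j rs_mx).
Proof.
move=> u u0; pose p := rVpoly u.
have p0 : p != 0 by apply: contraNneq u0 => /(congr1 (@poly_rV L a)); rewrite rVpolyK linear0 => ->.
have E y : (u *m map_mx j rs_mx) 0 y =
    if rs_point y is Some c then p.[j c] else p`_a.-1.
  rewrite mxE; under eq_bigr do rewrite !mxE.
  case: (rs_point y) => [c|].
    rewrite (@horner_coef_wide _ a) ?size_poly //; apply: eq_bigr => i _.
    by rewrite coef_rVpoly_ord rmorphXn.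
  have la : (a.-1 < a)%N by rewrite ltn_predL.
  rewrite (bigD1 (Ordinal la)) //= eqxx rmorph1 mulr1 big1 ?addr0.
    by rewrite (coef_rVpoly_ord u (Ordinal la)).
  move=> i ni; rewrite (_ : (_ == _) = false) ?rmorph0 ?mulr0 //.
  by apply: contraNF ni => /eqP h; apply/eqP/val_inj.
pose Z := [set y | (u *m map_mx j rs_mx) ord0 y == 0].
pose I := rs_point @: Z; pose C := [set c | Some c \in I].
have cZ : #|Z| = ((None \in I) + #|C|)%N.
  rewrite -(card_imset _ rs_point_inj) -/I (cardsD1 None); congr (_ + _)%N.
  have -> : I :\ None = Some @: C.
    apply/setP => -[c|]; rewrite !inE /=.
      apply/idP/imsetP => [cI|[c' + [->]]]; last by rewrite inE.
      by exists c; rewrite ?inE.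
    by symmetry; apply/negbTE/negP => /imsetP[].
  by rewrite card_imset // => c c' [].
have rC : (#|C| < size p)%N.
  rewrite cardE -(size_map j); apply: max_poly_roots => //.
    apply/allP => _ /mapP[c cC ->]; move: cC; rewrite mem_enum inE => /imsetP[y yZ cy].
    by move: yZ; rewrite inE E -cy => /eqP; rewrite rootE => ->.
  by rewrite map_inj_uniq ?enum_uniq //; apply: fmorph_inj.
rewrite -/Z cZ; case NI: (None \in I); last by apply: leq_trans rC (size_poly _ _).
move/imsetP: NI => [y yZ ny]; move: yZ; rewrite inE E -ny => /eqP pa.
rewrite add1n -[X in (_ < X)%N](prednK a0) ltnS; apply: leq_trans rC _.
apply/leq_sizeP => i; rewrite leq_eqVlt => /orP[/eqP <- //|ai].
by apply: nth_default; apply: leq_trans (size_poly _ _) _; rewrite -(prednK a0).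
Qed.
End ReedSolomon.

Section Moore.
Variables (K : finFieldType) (L : fieldType) (j : {rmorphism K -> L}).
Local Notation q := #|K|.

Lemma comb_expq n (u : 'I_n -> L) (x : 'rV[K]_n) s :
  comb j u x ^+ (q ^ s) = comb j (fun i => u i ^+ (q ^ s)) x.
Proof.
have [p pK pq] := card_pnat K.
have pL : p \in [pchar L] by rewrite (fmorph_pchar j).
have pQ : (p : nat_pred).-nat (q ^ s)%N by rewrite pnatX pq.
rewrite /comb; elim/big_ind2: _ => [|x1 y1 x2 y2 <- <-|i _].
- by rewrite expr0n gtn_eqF // expn_gt0 ltnW // finNzRing_gt1.
- by rewrite exprDn_pchar // (eq_pnat _ (pcharf_eq pL)).
- by rewrite exprMn -rmorphXn /= expf_cardX.
Qed.

(** A kernel vector of the transposed Moore matrix would give a nonzero polynomial in the monomials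
    ['X^(q ^ s)], of degree at most [q ^ n.-1], vanishing at the [q ^ n] distinct [K]-combinations
    of the [u i]. *)
Lemma moore_free n (u : 'I_n -> L) h (c : 'I_n -> L) : indep j u -> (n <= h)%N ->
  (forall s, (s < h)%N -> \sum_i c i * u i ^+ (q ^ s) = 0) -> forall i, c i = 0.
Proof.
move=> iu nh hc.
pose M : 'M[L]_n := \matrix_(i, s) u i ^+ (q ^ s).
suff M0 : \det M != 0.
  move=> i; have cM : (\row_i c i) *m M = 0.
    apply/rowP => s; rewrite !mxE -[RHS](hc s) ?(leq_trans (ltn_ord s)) //.
    by apply: eq_bigr => i' _; rewrite !mxE.
  have : (\row_i c i) = 0.
    by rewrite -[LHS](mulmxK (_ : M \in unitmx)) ?cM ?mul0mx // unitmxE unitfE.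
  by move=> /rowP/(_ i); rewrite !mxE.
rewrite -det_tr; apply/negP => /det0P[d d0 dM].
have n0 : (0 < n)%N.
  rewrite lt0n; apply: contraNneq d0 => nz; apply/eqP/rowP => -[t tn].
  by exfalso; rewrite nz in tn.
have q1 : (1 < q)%N := finNzRing_gt1 K.
pose P : {poly L} := \sum_(s < n) d 0 s *: 'X^(q ^ s).
have sP : (size P <= (q ^ n.-1).+1)%N.
  apply: leq_trans (size_sum _ _ _) _; apply/bigmax_leqP => s _.
  apply: leq_trans (size_scale_leq _ _) _; rewrite size_polyXn ltnS leq_exp2l //.
  by rewrite -ltnS prednK.
have P0 : P != 0.
  apply: contraNneq d0 => Pz; apply/eqP/rowP => s.
  have := congr1 (fun p : {poly L} => p`_(q ^ s)) Pz.
  rewrite /= coef_sum coef0 mxE (bigD1 s) //= coefZ coefXn eqxx mulr1 big1 ?addr0 // => t ts.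
  by rewrite coefZ coefXn eqn_exp2l // eq_sym (negbTE ts : (_ == _ :> nat) = false) mulr0.
have rP (x : 'rV[K]_n) : root P (comb j u x).
  rewrite rootE horner_sum; under eq_bigr do rewrite hornerZ hornerXn comb_expq /comb mulr_sumr.
  rewrite exchange_big /= big1 // => i _.
  under eq_bigr do rewrite mulrCA; rewrite -mulr_sumr.
  have /rowP/(_ i) := dM; rewrite !mxE => h0.
  rewrite -[X in _ * X = _](_ : 0 = _) ?mulr0 // -[LHS]h0.
  by apply: eq_bigr => s _; rewrite !mxE.
have cI : injective (comb j u).
  move=> x y xy; apply/eqP; rewrite -subr_eq0; apply/eqP/iu.
  by rewrite addrC -scaleN1r combP rmorphN1 mulN1r xy addNr.
have := @max_poly_roots _ P [seq comb j u x | x <- enum 'rV[K]_n] P0.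
rewrite size_map -cardE card_mx mul1n map_inj_uniq ?enum_uniq // => /(_ _ isT).
move=> h1; have /h1 : all (root P) [seq comb j u x | x <- enum 'rV[K]_n].
  by apply/allP => _ /mapP[x _ ->].
rewrite ltnNge => /negP; apply; apply: leq_trans sP _.
by rewrite ltn_exp2l // ltn_predL.
Qed.
End Moore.

(** Take a splitting field of ['X^Q - 'X]. The roots are distinct, the derivative being [-1], and
    they form the fixed field of the [m]-th power of Frobenius, hence the whole field, which has [Q]
    elements. *)
Lemma exists_field_extension (K : finFieldType) m : (0 < m)%N ->
  exists (L : finFieldType) (j : {rmorphism K -> L}) (b : 'I_m -> L),
    indep j b /\ #|L| = (#|K| ^ m)%N.
Proof.
move=> m0; set q := #|K|; set Q := (q ^ m)%N.
have q1 : (1 < q)%N := finNzRing_gt1 K.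
have Q1 : (1 < Q)%N by rewrite -(expn0 q) ltn_exp2l.
have sX (R : fieldType) : size ('X^Q - 'X : {poly R}) = Q.+1.
  by rewrite size_polyDl size_polyXn // size_polyN size_polyX.
have /FinSplittingFieldFor[L [zs Dzs defL]] : 'X^Q - 'X != 0 :> {poly K}.
  by rewrite -size_poly_gt0 sX.
rewrite rmorphB rmorphXn /= map_polyX in Dzs.
pose Fm := FinFieldExtType L.
have /finField_galois_generator[/= a _ Da] : (1 <= {:L})%VS by apply: sub1v.
rewrite dimv1 expn1 -/q in Da.
have Q0 : Q%:R = 0 :> L.
  by rewrite -(rmorph_nat (in_alg L)) card_natr0 // rmorph0.
have Uzs : uniq zs.
  rewrite -separable_prod_XsubC -(eqp_separable Dzs) unlock.
  rewrite derivB derivXn derivX -scaler_nat Q0 scale0r sub0r.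
  by rewrite -[- 1 in X in coprimep _ X]scaleN1r coprimepZr ?oppr_eq0 ?oner_eq0 // coprimep1.
have in_zs : zs =i fixedSpace (a ^+ m)%g.
  move=> z; rewrite -root_prod_XsubC -(eqp_root Dzs) (sameP fixedSpaceP eqP).
  rewrite /root !hornerE subr_eq0 /Q; congr (_ == z).
  elim: (m) => [|i IHi]; first by rewrite gal_id.
  by rewrite expgSr expnSr exprM IHi galM ?Da ?memvf.
have fixL : fixedSpace (a ^+ m)%g = {:L}%VS.
  have zs_fix : (<<1 & zs>> <= fixedSpace (a ^+ m)%g)%VS.
    rewrite -[X in (_ <= X)%VS]subfield_closed agenvS //.
    by rewrite subv_add sub1v; apply/span_subvP => z; rewrite in_zs.
  by apply/eqP; rewrite eqEsubv subvf; rewrite defL in zs_fix.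
have cardL : #|Fm| = Q.
  have /eq_card -> : Fm =i zs by move=> z; rewrite in_zs fixL memvf.
  apply: succn_inj; rewrite (card_uniqP _) // -(size_prod_XsubC _ id).
  by rewrite -(eqp_size Dzs) sX.
have dimL : \dim {:L} = m.
  apply/eqP; rewrite -(eqn_exp2l _ _ q1) -/Q -cardL.
  rewrite -(@card_vspacef K Fm (Vector.class L)).
  by rewrite (@card_vspace K Fm (Vector.class L)).
pose X := vbasis {:L}; have fX : free X := basis_free (vbasisP _).
exists Fm, (in_alg L), (fun i : 'I_m => X`_i); split=> // c hc.
move: fX hc; rewrite /X; move: (vbasis _); rewrite dimL => {}X /freeP fX hc.
apply/rowP => i; rewrite mxE; apply: (fX (fun i => c 0 i)).
by rewrite -[RHS]hc /comb; apply: eq_bigr => k _; rewrite mulr_algl.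
Qed.

(** * The parity-check matrix *)

Lemma sum_blocks (V : nmodType) g r (r0 : (0 < r)%N) (f : 'I_(g * r) -> V) :
  \sum_t f t = \sum_k \sum_y f (position k y).
Proof.
rewrite pair_bigA /= (reindex (fun p : 'I_g * 'I_r => position p.1 p.2)) //=.
exists (fun t => (block r0 t, offset r0 t)) => [[k y] _|t _] /=.
  by rewrite block_position offset_position.
by rewrite positionK.
Qed.

Lemma mx_at_val (L : nzRingType) m n (H : 'M[L]_(m, n)) i t : mx_at H (val i) (val t) = H i t.
Proof. by rewrite /mx_at !valK. Qed.

Section Construction.
Variables (K : finFieldType) (L : fieldType) (j : {rmorphism K -> L}).
Variables (g r a h m : nat).
Hypotheses (r0 : (0 < r)%N) (a0 : (0 < a)%N) (ar : (a <= r)%N) (rq : (r <= #|K|.+1)%N).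
Variables (b : 'I_m -> L) (G : 'M[K]_(g * r, m)).
Hypotheses (ib : indep j b) (bG : block_independent r0 h G).

Local Notation A := (rs_mx a rq).

(** Since [b] is independent, [K]-relations among these points are exactly those among the rows of
    [G]. *)
Definition moore_point (t : 'I_(g * r)) : L := comb j b (row t G).

Definition mr_mx : 'M[L]_(g * a + h, g * r) := col_mx
  (\matrix_(i, t) if block a0 i == block r0 t then j (A (offset a0 i) (offset r0 t)) else 0)
  (\matrix_(s, t) moore_point t ^+ (#|K| ^ s)).

Definition block_row (R : nzRingType) (x : 'rV[R]_(g * r)) k : 'rV[R]_r :=
  \row_y x 0 (position k y).

(** The local checks, transposed and with entries in [K]: elimination is done over [K] before
    scalars are extended to [L]. *)
Definition checks : 'M[K]_(g * r, g * a) :=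
  \matrix_(t, i) if block a0 i == block r0 t then A (offset a0 i) (offset r0 t) else 0.

Lemma checks_block (x : 'rV[K]_(g * r)) k : x *m checks = 0 -> block_row x k *m A^T = 0.
Proof.
move=> /rowP h0; apply/rowP => z; have := h0 (position k z).
rewrite !mxE (sum_blocks r0) (bigD1 k) //= [X in _ + X]big1 ?addr0 => [e|k' k'k].
  rewrite -[RHS]e; apply: eq_bigr => y _.
  by rewrite !mxE !block_position !offset_position eqxx.
rewrite big1 // => y _; rewrite !mxE !block_position eq_sym (negbTE k'k).
by rewrite mulr0.
Qed.

Lemma A_weighted : row_weighted A.
Proof. by have := rs_row_weighted a0 rq (idfun : {rmorphism K -> K}); rewrite map_mx_id. Qed.

Lemma checks_eq0 (x : 'rV[K]_(g * r)) k : x *m checks = 0 ->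
  (#|[set t | (block r0 t == k) && (x ord0 t != 0%R)]| <= a)%N -> block_row x k = 0.
Proof.
move=> /(checks_block k) xA sx; apply: (row_weighted_dual ar A_weighted xA).
apply: leq_trans sx; rewrite -(card_imset _ (_ : injective (position k))); last first.
  by move=> y y' /(congr1 (offset r0)); rewrite !offset_position.
apply: subset_leq_card; apply/subsetP => t /imsetP[y + ->].
by rewrite !inE mxE block_position eqxx.
Qed.

Lemma block_row_eq0 (R : nzRingType) (x : 'rV[R]_(g * r)) :
  (forall k, block_row x k = 0) -> x = 0.
Proof.
move=> x0; apply/rowP => t; have /rowP/(_ (offset r0 t)) := x0 (block r0 t).
by rewrite !mxE positionK.
Qed.

(** * Independence of a fixed set of columns *)

Section Selection.
Variable S : {set 'I_(g * r)}.
Hypotheses (cS : #|S| = (g * a + h)%N)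
  (Sk : forall k : 'I_g, (a <= #|[set t in S | block r0 t == k]|)%N).

(** Its left kernel consists of the vectors supported on [S] that satisfy all local checks. *)
Definition constraints : 'M[K]_(g * r, g * a + g * r) :=
  row_mx checks (\matrix_(t, t') ((t == t') && (t \notin S))%:R).

Lemma constraintsP (R : fieldType) (jj : {rmorphism K -> R}) (x : 'rV[R]_(g * r)) :
  x *m map_mx jj constraints = 0 <->
  x *m map_mx jj checks = 0 /\ forall t, t \notin S -> x 0 t = 0.
Proof.
rewrite map_row_mx mul_mx_row; set X := x *m map_mx jj (\matrix_(_, _) _).
have XE t : X 0 t = if t \in S then 0 else x 0 t.
  rewrite mxE (bigD1 t) //= big1 ?addr0 => [|t' t't].
    by rewrite !mxE eqxx; case: (t \in S); rewrite /= ?rmorph0 ?rmorph1 ?mulr0 ?mulr1.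
  by rewrite !mxE (negbTE t't) rmorph0 mulr0.
split=> [|[-> hx]].
  rewrite -(row_mx0 _ 1) => /eq_row_mx[-> /rowP X0]; split=> // t tS.
  by have := X0 t; rewrite XE (negbTE tS) mxE.
rewrite (_ : X = 0) ?row_mx0 //; apply/rowP => t; rewrite XE mxE.
by case: ifPn => // /hx.
Qed.

Lemma constraintsKP (x : 'rV[K]_(g * r)) : x *m constraints = 0 ->
  x *m checks = 0 /\ forall t, t \notin S -> x 0 t = 0.
Proof.
move=> x0; have [+ _] := constraintsP (idfun : {rmorphism K -> K}) x.
by rewrite !map_mx_id //; apply.
Qed.

(** The local checks kill every block with exactly [a] columns in [S]. Each other block contains one
    of the [h] columns of [S] in excess of [a] per block. *)
Lemma constraints_support (x : 'rV[K]_(g * r)) : x *m constraints = 0 ->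
  (#|block_support r0 x| <= h)%N.
Proof.
move=> /constraintsKP[xc xS].
pose Sb k := [set t in S | block r0 t == k].
have cSb : (\sum_(k < g) (#|Sb k| - a) = h)%N.
  have : (\sum_(k < g) #|Sb k| = g * a + h)%N.
    rewrite -cS -sum1_card (partition_big (block r0) xpredT) //=.
    apply: eq_bigr => k _; rewrite -sum1_card; apply: eq_bigl => t.
    by rewrite inE.
  have -> : (\sum_(k < g) #|Sb k| = \sum_(k < g) (#|Sb k| - a) + g * a)%N.
    rewrite -[X in (_ + X * a)%N](card_ord g) -sum_nat_const -big_split /=.
    by apply: eq_bigr => k _; rewrite subnK // Sk.
  by rewrite addnC => /addnI.
rewrite -cSb -sum1_card big_mkcond /=; apply: leq_sum => k _.
case: ifP => // /imsetP[t]; rewrite inE => xt ->; rewrite subn_gt0 ltnNge.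
apply/negP => sa; move/negP: xt; apply.
have /rowP/(_ (offset r0 t)) : block_row x (block r0 t) = 0.
  apply: checks_eq0 => //; apply: leq_trans sa; apply: subset_leq_card.
  apply/subsetP => t'; rewrite !inE => /andP[-> xt']; rewrite andbT.
  by apply: contraNT xt' => /xS ->.
by rewrite !mxE positionK => ->.
Qed.

(** Choose [a] columns of [S] in each block; [h] columns remain. A solution vanishing on these has
    at most [a] nonzero entries per block, hence is zero, so restriction to them is injective. *)
Lemma constraints_rank : (\rank (kermx constraints) <= h)%N.
Proof.
have exS0 k : exists B : {set 'I_(g * r)},
    B \subset [set t in S | block r0 t == k] /\ #|B| = a.
  by have [B] := subset_of_card (Sk k); exists B.
have [S0 hS0] := choice exS0.
pose S1 := S :\: \bigcup_k S0 k.
have cU : #|\bigcup_k S0 k| = (g * a)%N.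
  rewrite -[X in (X * a)%N](card_ord g) -sum_nat_const.
  have /eqP -> : #|\bigcup_k S0 k| == (\sum_k #|S0 k|)%N.
    rewrite eq_sym; apply/eqP.
    rewrite -sum1_card (partition_big (block r0) xpredT) //=; apply: eq_bigr => k _.
    rewrite -sum1_card; apply: eq_bigl => t.
    have [/subsetP sub _] := hS0 k.
    apply/idP/andP => [tS|[/bigcupP[k' _ tS'] /eqP tk]].
      split; first by apply/bigcupP; exists k.
      by have := sub _ tS; rewrite inE => /andP[].
    have [/subsetP /(_ _ tS')] := hS0 k'.
    by rewrite inE => /andP[_ /eqP tk'] _; rewrite -tk tk'.
  by apply: eq_bigr => k _; case: (hS0 k).
have cS1 : #|S1| = h.
  rewrite cardsD (setIidPr _) ?cS ?cU ?addKn //.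
  apply/bigcupsP => k _; have [sub _] := hS0 k; apply: subset_trans sub _.
  by apply/subsetP => t; rewrite inE => /andP[].
pose Y := row_base (kermx constraints).
pose P : 'M[K]_(\rank (kermx constraints), #|S1|) := \matrix_(l, i) Y l (enum_val i).
rewrite -[X in (_ <= X)%N]cS1; suff /eqP <- : row_free P by apply: rank_leq_col.
rewrite -kermx_eq0; apply: contraT => /rowV0Pn[c /sub_kermxP cP c0].
have xc : c *m Y *m constraints = 0.
  by rewrite -mulmxA (_ : Y *m _ = 0) ?mulmx0 //; apply/sub_kermxP; rewrite eq_row_base.
have [xch xS] := constraintsKP xc.
have xS1 t : t \in S1 -> (c *m Y) 0 t = 0.
  move=> tS; have /rowP/(_ (enum_rank_in tS t)) := cP; rewrite !mxE => e.
  by rewrite -[RHS]e; apply: eq_bigr => l _; rewrite [P _ _]mxE enum_rankK_in.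
have : c *m Y = 0.
  apply: (block_row_eq0) => k; apply: checks_eq0 => //.
  have [sub cB] := hS0 k; rewrite -[X in (_ <= X)%N]cB; apply: subset_leq_card.
  apply/subsetP => t; rewrite inE => /andP[/eqP tk xt].
  have tS : t \in S by apply: contraNT xt => /xS ->.
  have : t \notin S1 by apply: contraNN xt => /xS1 ->.
  rewrite inE tS andbT negbK => /bigcupP[k' _ tk'].
  have [/subsetP /(_ _ tk')] := hS0 k'.
  by rewrite inE => /andP[_ /eqP kk'] _; rewrite -tk kk'.
by move/eqP; rewrite mulmx_free_eq0 ?row_base_free // (negbTE c0).
Qed.

(** In coordinates along a [K]-basis [Y] of the solutions of the constraints, the global rows become
    the Moore system of the [theta l], because [q]-th powers are additive and fix [K]. A
    [K]-relation among the [theta l] is a relation among rows of [G] in at most [h] blocks, hence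
    trivial. *)
Lemma mr_independent (x : 'cV[L]_(g * r)) : (forall t, t \notin S -> x t ord0 = 0) ->
  mr_mx *m x = 0 -> x = 0.
Proof.
move=> xS; rewrite mul_col_mx => Hx.
have [xtop xbot] := eq_col_mx (etrans Hx (esym (col_mx0 _ _ _ _))).
have xB : x^T *m map_mx j constraints = 0.
  apply/constraintsP; split=> [|t tS]; last by rewrite mxE xS.
  rewrite -[LHS]trmxK trmx_mul trmxK -[RHS]trmx0; congr (_^T); rewrite -[RHS]xtop.
  congr (_ *m _); apply/matrixP => i t; rewrite !mxE.
  by case: ifP; rewrite ?rmorph0.
pose Y := row_base (kermx constraints).
(* Taking kernels commutes with the extension of scalars from [K] to [L]. *)
have [c xc] : exists c, x^T = c *m map_mx j Y.
  have /sub_kermxP : x^T *m map_mx j constraints = 0 := xB.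
  rewrite -map_kermx => /submxP[c1 ->].
  have /submxP[c2 kY] : (kermx constraints <= Y)%MS by rewrite eq_row_base.
  exists (c1 *m map_mx j c2); rewrite -mulmxA -map_mxM -/Y; congr (_ *m map_mx j _).
  exact: kY.
have YB (d : 'rV_(\rank (kermx constraints))) : d *m Y *m constraints = 0.
  by rewrite -mulmxA (_ : Y *m _ = 0) ?mulmx0 //; apply/sub_kermxP; rewrite eq_row_base.
pose theta l := comb j moore_point (row l Y).
have it : indep j theta.
  move=> d; rewrite -(comb_sum j moore_point) -(comb_sum j b) => /ib dYG.
  have := bG dYG (constraints_support (YB d)).
  by move/eqP; rewrite mulmx_free_eq0 ?row_base_free // => /eqP.
have c0 l : c 0 l = 0.
  apply: (moore_free it constraints_rank (c := fun l => c 0 l)) => s sh.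
  have /colP/(_ (Ordinal sh)) := xbot; rewrite !mxE => e; rewrite -[RHS]e.
  under eq_bigr do rewrite comb_expq /comb mulr_sumr.
  rewrite exchange_big /=; apply: eq_bigr => t _.
  have -> : x t 0 = \sum_l c 0 l * j (Y l t).
    have /rowP/(_ t) := xc; rewrite !mxE => ->.
    by apply: eq_bigr => l' _; rewrite mxE.
  rewrite mxE mulr_sumr; apply: eq_bigr => l' _; rewrite !mxE; ring.
by rewrite -[x]trmxK xc (_ : c = 0) ?mul0mx ?trmx0 //; apply/rowP => l; rewrite c0 mxE.
Qed.
End Selection.

Theorem mr_mx_MR : MR_LRC mr_mx.
Proof.
split; [|split].
- move=> i t; rewrite -[i]splitK; case: (split i) => i' /= ig it.
    rewrite col_mxEu mxE; case: eqP => // /(congr1 val) /= e.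
    by rewrite e eqxx in it.
  by move: ig; rewrite ltnNge leq_addr.
- move=> k A'; have -> : A' = map_mx j A.
    apply/matrixP => z y; rewrite !mxE.
    have := mx_at_val mr_mx (lshift h (position k z)) (position k y) => /= ->.
    by rewrite col_mxEu mxE !block_position eqxx !offset_position !mxE.
  have wA := rs_row_weighted a0 rq j.
  split.
    apply/eqP; change (row_free (map_mx j A)).
    rewrite -kermx_eq0; apply: contraT => /rowV0Pn[u /sub_kermxP uA u0].
    have := wA u u0; rewrite uA (_ : [set _ | _] = setT) ?cardsT ?card_ord; first by lia.
    by apply/setP => y; rewrite !inE mxE eqxx.
  move=> u u0; have := wA u u0.
  rewrite (cardsCs [set y | (u *m _) ord0 y == 0]) card_ord.
  rewrite (_ : ~: _ = [set y | (u *m map_mx j A) ord0 y != 0]); first by lia.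
  by apply/setP => y; rewrite !inE.
- move=> S cS Sk x xS; apply: (mr_independent cS) => // k.
Qed.
End Construction.

Theorem theorem4p2 (K : finFieldType) (r g a h gg : nat)
    (F : fieldType) (iota : {rmorphism K -> F}) :
  (0 < r)%N -> (0 < g)%N -> (0 < a)%N -> (0 < h)%N ->
  (a <= r)%N -> (r <= #|K|.+1)%N -> (g * a + h < g * r)%N ->
  function_field iota -> genus iota gg ->
  (exists D : 'I_g -> ((F -> int) -> int),
      (forall i, is_divisor iota (D i) /\ positive_divisor (D i) /\
                 divisor_deg iota (D i) r%:Z) /\
      (forall i j, i != j -> forall v, D i v != 0 -> D j v = 0)) ->
  exists (L : finFieldType) (H : 'M[L]_(g * a + h, g * r)),
    #|L| = (#|K| ^ (2 * gg + minn (h * r) (g * r)))%N /\ MR_LRC H.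
Proof.
move=> r0 g0 a0 h0 ar rq _ [[x [tx [m [b fx]]]] alg] hgg [D [hD disj]].
have place_degE := exists_place_deg tx fx.
have [G bG] : exists G : 'M[K]_(g * r, 2 * gg + minn (h * r) (g * r)),
    block_independent r0 h G.
  have [hg|gh] := ltnP h g.
    rewrite (minn_idPl _) ?leq_mul2r ?(ltnW hg) ?orbT //.
    apply: (exists_block_independent place_degE hgg alg r0 hg _ _ disj) => i.
      by case: (hD i) => _ [].
    by case: (hD i) => _ [_ /(divisor_degP place_degE)].
  rewrite (minn_idPr _) ?leq_mul2r ?gh ?orbT //.
  (* For [h >= g] all rows together must be independent: an identity matrix padded with zero
     columns. *)
  exists (pid_mx (g * r)) => y /eqP; rewrite mulmx_free_eq0 => [/eqP //|].
  by rewrite /row_free rank_pid_mx ?leq_addl.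
have m0 : (0 < 2 * gg + minn (h * r) (g * r))%N.
  by rewrite addn_gt0 leq_min !muln_gt0 h0 g0 r0 orbT.
have [L [j [u [iu cL]]]] := exists_field_extension K m0.
by exists L, (mr_mx j h r0 a0 rq u G); split=> //; apply: mr_mx_MR.
Qed.
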